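(* Let $T\subset\mathbb R^2$ be a (non-degenerate) triangle with vertices $p_0,p_1,p_2$, let $X_n$ be a set of $n$ independent uniformly distributed random points of $T$, and let $L_n$ be the length of a longest convex chain (from $p_0$ to $p_2$) in $X_n$. There exists a positive constant $\alpha$ for which $$\lim_{n\to\infty}\frac{\mathbb E L_n}{\sqrt[3]{n}}=\alpha.$$
   Context: A subset $Y\subset X_n$ is a convex chain in $T$ (from $p_0$ to $p_2$) if the convex hull of $Y\cup\{p_0,p_2\}$ is a convex polygon with exactly $|Y|+2$ vertices. The length of the convex chain $Y$ is $|Y|$. The distribution of $L_n$ does not depend on the choice of $T$, by affine invariance. *)

(* Defs.v *)
From mathcomp Require Import all_boot all_order all_algebra.
From mathcomp Require Import finmap.
From mathcomp Require Import all_classical all_reals all_analysis.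
Set Implicit Arguments.
Unset Strict Implicit.
Unset Printing Implicit Defensive.
Import Order.TTheory GRing.Theory Num.Theory.
Import numFieldNormedType.Exports.
Local Open Scope classical_set_scope.
Local Open Scope ring_scope.

Definition convex_hull (R : realType) (A : set (R * R)) : set (R * R) :=
  smallest (@convex_set R (R * R)%type) A.

Definition nondegenerate_triangle (R : realType) (p0 p1 p2 : R * R) : Prop :=
  forall a b : R, a *: (p1 - p0) + b *: (p2 - p0) = 0 -> a = 0 /\ b = 0.

Definition triangle (R : realType) (p0 p1 p2 : R * R) : set (R * R) :=
  convex_hull [set p0; p1; p2].

(* Extreme points: for a convex polygon, its corners in the strict sense. *)
Definition vertices (R : realType) (C : set (R * R)) : set (R * R) :=
  [set x | C x /\
    forall (y z : R * R) (t : R), C y -> C z -> 0 < t < 1 ->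
      x = t *: y + (1 - t) *: z -> y = z].

(* The hull of a finite set is a polygon, so only its vertices are counted;
   the empty chain, whose hull is the segment [p0, p2], has length 0. *)
Definition convex_chain (R : realType) (p0 p2 : R * R) (Y : {fset R * R})
    : Prop :=
  (vertices (convex_hull ([set` Y] `|` [set p0; p2])) #= `I_(#|` Y| + 2))%card.

Definition longest_chain (R : realType) (p0 p2 : R * R) (S : {fset R * R})
    : nat :=
  (\max_(Y <- fpowerset S | `[< convex_chain p0 p2 Y >]) #|` Y|)%N.

Definition area (R : realType) : set (R * R) -> \bar R :=
  (@lebesgue_measure R \x @lebesgue_measure R)%E.

Definition uniform_on (R : realType) (T : set (R * R)) d
    (Omega : measurableType d) (P : probability Omega R)
    (X : {RV P >-> (R * R)%type}) : Prop :=
  forall A : set (R * R), measurable A ->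
    distribution P X A = (area (A `&` T) / area T)%E.

Definition mutually_independent (R : realType) d d' (Omega : measurableType d)
    (E : measurableType d') (P : probability Omega R) (I : finType)
    (X : I -> {RV P >-> E}) : Prop :=
  forall (J : {set I}) (A : I -> set E),
    (forall i, i \in J -> measurable (A i)) ->
    P (\bigcap_(i in [set i | i \in J]) (X i @^-1` A i)) =
    (\prod_(i in J) P (X i @^-1` A i))%E.

Definition random_set (R : realType) d (Omega : measurableType d)
    (P : probability Omega R) n (X : 'I_n -> {RV P >-> (R * R)%type})
    (w : Omega) : {fset R * R} :=
  [fset X i w | i : 'I_n]%fset.

(* Main.v *)
Require Import Defs.
From mathcomp Require Import all_boot all_order all_algebra.
From mathcomp Require Import finmap.
From mathcomp Require Import all_classical all_reals all_analysis.
From mathcomp Require Import measurable_realfun.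
From mathcomp Require Import ring lra zify.
Import Order.TTheory GRing.Theory Num.Theory.
Import numFieldNormedType.Exports.
Local Open Scope classical_set_scope.
Local Open Scope ring_scope.

(** The proof takes all triangles to one standard triangle, with vertices
[(0, 0)], [(1 / 2, 0)], [(1, 1)]: an affine map preserves chains and multiplies
areas by a constant, so it takes uniform points to uniform points. There the
parabola [y = x ^ 2] joins the first vertex to the last and is tangent to the
two other sides, and a chain is a set of points each of which lies on a line
passing strictly below all the others and the two end vertices ([convex_chainE]).
Write [e n] for the expected length of a longest chain among [n] points; it
depends on [n] only ([expected_cup_law]).

Superadditivity. Cut the parabola into [k] arcs over intervals of equal length.
The end tangents of an arc and its chord bound a triangle, which an affine map
[zoom] takes to the standard one, and whose share of the area is [1 / k ^ 3].
Chains found in these triangles unite to a chain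
([longest_cup_superadditive]), since each triangle lies above the tangents at
the ends of the other arcs. The number of points in one of the triangles is
binomial, and given which points fall there they are again independent and
uniform ([pattern_cup]). If [n] exceeds [(1 + d) m k ^ 3], then by Chernoff's
bound [e n >= k (1 - rho ^ m) e m] for some [rho < 1] that depends on [d] only
([expected_cup_superadditive]).

Upper bound. All points of a chain lie on the graph of a convex function with
slopes between 0 and 2. Round its heights at [0, 1 / m, 2 / m, ...] down to
multiples of [1 / m ^ 2]. The rounded heights are encoded by an increasing
sequence of [m] integers below [4 m], so that there are at most [2 ^ (4 m)]
codes, and the convex functions with a given code have their graphs in a union
of thin strips of total area at most [6 / m ^ 2] ([cup_code],
[area_code_region]). If [n <= m ^ 3], then of the order of [m] points are
expected in such a union, and a union bound over the codes shows that with high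
probability none contains more than a fixed multiple of [m] points. Hence
[e n <= K m + 1] ([expected_cup_le]).

Limit. By the upper bound the ratios [e n / n ^ (1 / 3)] are bounded. Let [alpha]
be the supremum of the numbers that infinitely many of them reach. If the ratio
of some large [m] is close to [alpha], then superadditivity brings all
sufficiently late ratios almost as high ([cubic_limit]). Finally [alpha] is
positive because [e 1] is. *)

Set Implicit Arguments.
Unset Strict Implicit.
Unset Printing Implicit Defensive.

(** * Convex hulls and extreme points *)

Lemma hull_convex (R : realType) (A : set (R * R)) x y (t : R) :
  convex_hull A x -> convex_hull A y -> 0 <= t <= 1 ->
  convex_hull A (t *: x + (1 - t) *: y).
Proof.
move=> Ax Ay /andP[t0 t1] B [cB AB].

have /set_mem := cB x y (Itv01 t0 t1) (mem_set (Ax _ (conj cB AB)))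
  (mem_set (Ay _ (conj cB AB))).
by [].
Qed.

Lemma sub_hull (R : realType) (A : set (R * R)) : A `<=` convex_hull A.
Proof. exact: sub_gen_smallest. Qed.

Lemma hull_min (R : realType) (A B : set (R * R)) :
  (forall x y (t : R), B x -> B y -> 0 <= t <= 1 ->
     B (t *: x + (1 - t) *: y)) ->
  A `<=` B -> convex_hull A `<=` B.
Proof.
move=> cB AB; apply: smallest_sub => // x y t /set_mem Bx /set_mem By.
apply/mem_set; have := cB x y t%:num Bx By; apply.
by rewrite ge0 le1.
Qed.

(** Removing an extreme point from a convex set leaves a convex set. *)
Lemma vertices_hull (R : realType) (A : set (R * R)) :
  vertices (convex_hull A) `<=` A.
Proof.
move=> x [Cx ex]; apply: contrapT => Ax.
suff H : convex_hull A `<=` convex_hull A `\ x by case: (H _ Cx) => _; apply.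
apply: hull_min; last first.
  move=> y Ay; split; first exact: sub_hull.
  by move=> /= yx; apply: Ax; rewrite -yx.
move=> y z t [Cy yx] [Cz zx] t01; split; first exact: hull_convex.
move=> /= /esym E; have [t0|t0] := eqVneq t 0.
  by apply: zx; rewrite E t0 scale0r add0r subr0 scale1r.
have [t1|t1] := eqVneq t 1.
  by apply: yx; rewrite E t1 scale1r subrr scale0r addr0.
have yz := ex _ _ t Cy Cz _ E; apply: yx.
have t01' : 0 < t < 1.
  by move/andP: t01 => [? ?]; rewrite !lt_neqAle eq_sym t0 t1; apply/andP.
by rewrite /= E -(yz t01') -scalerDl addrC subrK scale1r.
Qed.

(** Together with the open half-plane on which the functional is larger, [q]
forms a convex set containing [A], hence the hull; [q] is extreme in it. *)
Lemma exposed_vertex (R : realType) (A : set (R * R)) (a b : R) q :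
  A q -> (forall r, A r -> r != q -> a * q.1 + b * q.2 < a * r.1 + b * r.2) ->
  vertices (convex_hull A) q.
Proof.
move=> Aq sep; split; first exact: sub_hull.
have H : convex_hull A `<=`
    [set r | r = q \/ a * q.1 + b * q.2 < a * r.1 + b * r.2].
  apply: hull_min => [x y t Hx Hy /andP[t0 t1]|r Ar]; last first.
    by have [->|/(sep _ Ar)] := eqVneq r q; [left|right].
  have [t0'|t0'] := eqVneq t 0.
    by move: Hy; rewrite t0' scale0r add0r subr0 scale1r.
  have [t1'|t1'] := eqVneq t 1.
    by move: Hx; rewrite t1' scale1r subrr scale0r addr0.
  have {t0'}t0 : 0 < t by rewrite lt_neqAle eq_sym t0' t0.
  have {t1'}t1 : t < 1 by rewrite lt_neqAle t1' t1.
  move: Hx Hy => /= [->|Hx] [->|Hy].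
  - by left; rewrite -scalerDl addrC subrK scale1r.
  - by right; rewrite /GRing.scale /=; nra.
  - by right; rewrite /GRing.scale /=; nra.
  - by right; rewrite /GRing.scale /=; nra.
move=> y z t /H /= Hy /H /= Hz /andP[t0 t1] E.
have EE : a * q.1 + b * q.2
    = t * (a * y.1 + b * y.2) + (1 - t) * (a * z.1 + b * z.2).
  by rewrite [in LHS]E /= /GRing.scale /=; ring.
case: Hy Hz => [yq|Hy] [zq|Hz]; first by rewrite yq zq.
- by exfalso; rewrite yq in EE; nra.
- by exfalso; rewrite zq in EE; nra.
- by exfalso; nra.
Qed.

(** * Convex chains through supporting lines *)

Definition std_triangle (R : realType) : set (R * R) :=
  [set q | [/\ 0 <= q.2, 2 * q.1 - 1 <= q.2 & q.2 <= q.1]].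

Lemma std_triangle_convex (R : realType) x y (t : R) :
  std_triangle x -> std_triangle y -> 0 <= t <= 1 ->
  std_triangle (t *: x + (1 - t) *: y).
Proof.
move=> [x1 x2 x3] [y1 y2 y3] /andP[t0 t1].
rewrite /std_triangle /= /GRing.scale /=; split; nra.
Qed.

Lemma triangleE (R : realType) :
  triangle (0, 0) (2^-1, 0) (1, 1) = @std_triangle R.
Proof.
apply/seteqP; split.
  apply: hull_min => [|x]; first exact: std_triangle_convex.
  by move=> [[->|->]|->]; rewrite /std_triangle /=; split; lra.
move=> [x y] [/= h1 h2 h3].
(* (x, y) = (1 - y) ((1 - s) p0 + s p1) + y p2 with s = 2 (x - y) / (1 - y) *)
have [y1|y1] := eqVneq y 1.
  by apply: sub_hull; right; congr (_, _); lra.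
have {}y1 : y < 1 by rewrite lt_neqAle y1; lra.
pose s := 2 * (x - y) / (1 - y).
have sE : s * (1 - y) = 2 * (x - y) by rewrite /s mulfVK// subr_eq0 gt_eqF.
have s0 : 0 <= s by apply: divr_ge0; lra.
have s1 : s <= 1 by rewrite ler_pdivrMr; lra.
have H : triangle (0, 0) (2^-1, 0) (1, 1)
    (s *: (2^-1, 0) + (1 - s) *: (0, 0) : R * R).
  by apply: hull_convex; [apply: sub_hull; left; right|
    apply: sub_hull; left; left|rewrite s0 s1].
have -> : (x, y) = y *: (1, 1) + (1 - y) *: (s *: (2^-1, 0) + (1 - s) *: (0, 0))
    :> (R * R).
  by congr (_, _); rewrite /= /GRing.scale /=; nra.
apply: hull_convex => //; first by apply: sub_hull; right.
by rewrite h1 ltW.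
Qed.

(** The line of slope [s] through [z i] passes strictly below the end vertices
[(0, 0)] and [(1, 1)] and below the other points of the family. *)
Definition supported (R : realType) (I : finType) (z : I -> R * R)
    (J : {set I}) (i : I) : Prop :=
  exists s : R, [/\ (z i).2 - s * (z i).1 < 0,
    (z i).2 + s * (1 - (z i).1) < 1 &
    forall j, j \in J -> j != i ->
      (z i).2 + s * ((z j).1 - (z i).1) < (z j).2].

(** Chains are index sets rather than sets of points, so that events about
chains are finite combinations of events about single points. *)
Definition cup (R : realType) (I : finType) (z : I -> R * R)
    (J : {set I}) : Prop :=
  forall i, i \in J -> std_triangle (z i) /\ supported z J i.

Definition longest_cup (R : realType) (I : finType) (z : I -> R * R) : nat :=
  \max_(J : {set I} | `[< cup z J >]) #|J|.

(** The slope from [a] to [q] is less than that from [q] to [b], multiplied out.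
Unlike [supported], the condition has no existential quantifier, and is
measurable in the three points. *)
Definition slopes_increase (R : realType) (a q b : R * R) : Prop :=
  a.1 < q.1 -> q.1 < b.1 ->
  (q.2 - a.2) * (b.1 - q.1) < (b.2 - q.2) * (q.1 - a.1).

Lemma seq_max (R : realType) (s : seq R) x :
  exists2 m, m \in x :: s & forall y, y \in x :: s -> y <= m.
Proof.
elim: s x => [|a s IH] x.
  by exists x => [|y]; rewrite ?mem_head// inE => /eqP ->.
have [m ms mP] := IH a; have [xm|mx] := leP x m.
  exists m => [|y]; first by rewrite inE ms orbT.
  by rewrite inE => /orP[/eqP ->//|/mP].
exists x => [|y]; first by rewrite mem_head.
by rewrite inE => /orP[/eqP ->//|/mP ym]; rewrite (le_trans ym)// ltW.
Qed.

Lemma seq_separate (R : realType) (L U : seq R) a b :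
  (forall l u, l \in a :: L -> u \in b :: U -> l < u) ->
  exists s, (forall l, l \in a :: L -> l < s) /\
            (forall u, u \in b :: U -> s < u).
Proof.
move=> LU; have [m mL mP] := seq_max L a.
have [m' mU mP'] := seq_max [seq - x | x <- U] (- b).
have {}mU : - m' \in b :: U.
  move: mU; rewrite -[_ :: _]/(map -%R (b :: U)) => /mapP[u uU ->].
  by rewrite opprK.
have mm := LU _ _ mL mU.
exists ((m - m') / 2); split => [l /mP lm|u uU]; first by lra.
have : - u <= m'.
  by apply: mP'; rewrite -[_ :: _]/(map -%R (b :: U)) map_f.
by lra.
Qed.

Section cup.
Variables (R : realType) (I : finType) (z : I -> R * R).
Implicit Types (J : {set I}).

Lemma cup_x01 J i : cup z J -> i \in J -> 0 < (z i).1 < 1.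
Proof.
move=> cJ iJ; have [[h1 h2 h3] [s [s0 s1 _]]] := cJ _ iJ.
have : (z i).1 != 0 by apply: contraTneq s0 => x0; rewrite -leNgt; nra.
have : (z i).1 != 1 by apply: contraTneq s1 => x0; rewrite -leNgt; nra.
move=> x1 x0; rewrite !lt_neqAle [0 == _]eq_sym x0 x1 /=; apply/andP; split; lra.
Qed.

Lemma cup_sub J J' : J' \subset J -> cup z J -> cup z J'.
Proof.
move=> /fintype.subsetP JJ cJ i /JJ iJ; have [Ti [s [s0 s1 sJ]]] := cJ _ iJ.
by split=> //; exists s; split => // j /JJ; exact: sJ.
Qed.

Lemma cup_inj J : cup z J -> {in J &, injective z}.
Proof.
move=> cJ i j iJ jJ zij; apply/eqP; apply: contraT => ij.
have [_ [s [_ _ /(_ j jJ)]]] := cJ _ iJ.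
by rewrite eq_sym ij zij subrr mulr0 addr0 ltxx => /(_ isT).
Qed.

Let others J i (a : R * R) :=
  [\/ a = (0, 0), a = (1, 1) | exists j, [/\ j \in J, j != i & a = z j]].

(** A supporting slope exists as soon as every slope to the left is less than
every slope to the right, since there are finitely many of them. *)
Lemma cupP J : cup z J <-> forall i, i \in J ->
  [/\ std_triangle (z i), 0 < (z i).1 < 1,
    forall j, j \in J -> j != i -> (z j).1 != (z i).1 &
    forall a b, others J i a -> others J i b -> slopes_increase a (z i) b].
Proof.
split=> [cJ i iJ|H i iJ].
  have x01 := cup_x01 cJ iJ; have [Ti [s [s0 s1 sJ]]] := cJ _ iJ.
  split=> // [j jJ ji|a b Ha Hb].
    apply/eqP => xji; have := sJ _ jJ ji.
    have [_ [s' [_ _ /(_ i iJ)]]] := cJ _ jJ.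
    by rewrite eq_sym ji xji subrr !mulr0 !addr0 
      => /(_ isT) /ltW; rewrite leNgt => /negP.
  suff H c : others J i c -> (z i).2 + s * (c.1 - (z i).1) < c.2.
    by move=> aq qb; have := H _ Ha; have := H _ Hb; nra.
  move=> [->|->|[j [jJ ji ->]]] /=; [lra|lra|exact: sJ].
have [Ti /andP[x0 x1] dx sl] := H _ iJ; split => //.
have oth j : j \in J -> j != i -> others J i (z j).
  by move=> jJ ji; apply: Or33; exists j.
pose sl_ (a : R * R) := (a.2 - (z i).2) / (a.1 - (z i).1).
have sl_E (a : R * R) : a.1 != (z i).1 -> sl_ a * (a.1 - (z i).1) = a.2 - (z i).2.
  by move=> ai; rewrite /sl_ mulfVK// subr_eq0.
pose L := [seq sl_ (z j) | j <- [seq j <- enum J | (z j).1 < (z i).1]].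
pose U := [seq sl_ (z j) | j <- [seq j <- enum J | (z i).1 < (z j).1]].
have [|s [sL sU]] := @seq_separate R L U (sl_ (0, 0)) (sl_ (1, 1)).
  move=> l u lL uU.
  have [a [oa ai ->]] : exists a, [/\ others J i a, a.1 < (z i).1 & l = sl_ a].
    move: lL; rewrite inE => /orP[/eqP ->|].
      by exists (0, 0); split => //; apply: Or31.
    move=> /mapP[j]; rewrite mem_filter mem_enum => /andP[ji jJ] ->.
    exists (z j); split => //.
    by apply: oth => //; apply: contraTneq ji => ->; rewrite ltxx.
  have [b [ob bi ->]] : exists b, [/\ others J i b, (z i).1 < b.1 & u = sl_ b].
    move: uU; rewrite inE => /orP[/eqP ->|].
      by exists (1, 1); split => //; apply: Or32.
    move=> /mapP[j]; rewrite mem_filter mem_enum => /andP[ji jJ] ->.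
    exists (z j); split => //.
    by apply: oth => //; apply: contraTneq ji => ->; rewrite ltxx.
  have := sl _ _ oa ob ai bi.
  have ea := sl_E a (negbT (lt_eqF ai)).
  have eb := sl_E b (negbT (gt_eqF bi)).
  have -> : (z i).2 - a.2 = sl_ a * ((z i).1 - a.1) by lra.
  have -> : b.2 - (z i).2 = sl_ b * (b.1 - (z i).1) by lra.
  rewrite mulrAC ltr_pM2r ?subr_gt0// ltr_pM2r ?subr_gt0//.
have lef (a : R * R) : a.1 < (z i).1 -> sl_ a < s ->
    (z i).2 + s * (a.1 - (z i).1) < a.2.
  by move=> ai as_; have := sl_E a (negbT (lt_eqF ai)); nra.
have rig (a : R * R) : (z i).1 < a.1 -> s < sl_ a ->
    (z i).2 + s * (a.1 - (z i).1) < a.2.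
  by move=> ai as_; have := sl_E a (negbT (gt_eqF ai)); nra.
exists s; split.
- by have := lef (0, 0) x0 (sL _ (mem_head _ _)); rewrite /=; lra.
- by have := rig (1, 1) x1 (sU _ (mem_head _ _)); rewrite /=; lra.
- move=> j jJ ji; have := dx j jJ ji; rewrite neq_lt => /orP[xji|xij].
    apply: lef => //; apply: sL; rewrite inE; apply/orP; right.
    by apply: map_f; rewrite mem_filter mem_enum jJ andbT.
  apply: rig => //; apply: sU; rewrite inE; apply/orP; right.
  by apply: map_f; rewrite mem_filter mem_enum jJ andbT.
Qed.

End cup.

Lemma cup_reindex (R : realType) (I K : finType) (f : K -> I)
    (z : I -> R * R) (A : {set K}) :
  {in A &, injective f} -> cup (z \o f) A <-> cup z (f @: A).
Proof.
move=> fi; split=> cA.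
  move=> _ /imsetP[k kA ->]; have [Tk [s [s0 s1 sJ]]] := cA _ kA.
  split=> //; exists s; split=> // _ /imsetP[l lA ->] lk; apply: sJ => //.
  by apply: contra_neq lk => ->.
move=> k kA; have [Tk [s [s0 s1 sJ]]] := cA _ (imset_f f kA).
split=> //; exists s; split=> // l lA lk; apply: sJ; first exact: imset_f.
by apply: contra_neq lk; exact: fi.
Qed.

Lemma longest_cup_ge (R : realType) (I : finType) (z : I -> R * R) (J : {set I}) :
  cup z J -> (#|J| <= longest_cup z)%N.
Proof.
move=> cJ; rewrite /longest_cup.
by rewrite (bigD1 J) ?leq_maxl//; apply/asboolP.
Qed.

Lemma longest_cup_le (R : realType) (I : finType) (z : I -> R * R) m :
  (forall J, cup z J -> #|J| <= m)%N -> (longest_cup z <= m)%N.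
Proof. by move=> H; apply/bigmax_leqP => J /asboolP; exact: H. Qed.

Lemma longest_cupP (R : realType) (I : finType) (z : I -> R * R) :
  exists2 J, cup z J & #|J| = longest_cup z.
Proof.
have c0 : cup z finset.set0 by move=> i; rewrite inE.
have [|J /asboolP cJ E] := @eq_bigmax_cond _
    [pred J : {set I} | `[< cup z J >]] (fun J => #|J|).
  by apply/card_gt0P; exists finset.set0; apply/asboolP.
by exists J => //; rewrite -E.
Qed.

Lemma longest_cup_comp (R : realType) (I K : finType) (f : K -> I)
    (z : I -> R * R) :
  injective f -> (longest_cup (z \o f) <= longest_cup z)%N.
Proof.
move=> fi; apply: longest_cup_le => J cJ; rewrite -(card_imset _ fi).
by apply: longest_cup_ge; apply/(cup_reindex z (in2W fi)).
Qed.

Lemma longest_cup_leq_card (R : realType) (I : finType) (z : I -> R * R) :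
  (longest_cup z <= #|I|)%N.
Proof. by apply: longest_cup_le => J _; exact: max_card. Qed.

(** The hull contains the diagonal, which passes through [q] or above it. If
the hull also reached below [q], then [q] would be interior to the diagonal or
to a vertical segment of the hull. *)
Lemma vertex_lowest (R : realType) (A : set (R * R)) (q u : R * R) :
  A (0, 0) -> A (1, 1) -> vertices (convex_hull A) q -> q.2 <= q.1 ->
  0 < q.1 < 1 -> convex_hull A u -> u.1 = q.1 -> q.2 <= u.2.
Proof.
move=> A0 A1 [Cq ex] q21 /andP[x0 x1] Cu u1; rewrite leNgt; apply/negP => uq.
have [C0 C1] := (sub_hull A0, sub_hull A1).
pose v := q.1 *: ((1, 1) : R * R) + (1 - q.1) *: (0, 0).
have Cv : convex_hull A v by apply: hull_convex => //; rewrite !ltW.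
have [E|qv] := eqVneq q.2 q.1.
  have : (1, 1) = (0, 0) :> R * R.
    apply: (ex _ _ q.1 C1 C0); first by rewrite x0 x1.
    by rewrite [LHS]surjective_pairing E; congr (_, _); rewrite /= /GRing.scale /=; ring.
  by case=> /eqP; rewrite oner_eq0.
have {}qv : q.2 < q.1 by rewrite lt_neqAle qv.
have d0 : q.1 - u.2 != 0 by rewrite gt_eqF//; lra.
pose t := (q.1 - q.2) / (q.1 - u.2).
have tE : t * (q.1 - u.2) = q.1 - q.2 by rewrite /t mulfVK.
have t0 : 0 < t by apply: divr_gt0; lra.
have t1 : t < 1 by rewrite ltr_pdivrMr; lra.
have : u = v.
  apply: (ex _ _ t Cu Cv); first by rewrite t0 t1.
  rewrite [LHS]surjective_pairing; congr (_, _); rewrite /= /GRing.scale /= ?u1; nra.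
by move=> uv; move: uq; rewrite uv /= /GRing.scale /=; lra.
Qed.

Lemma std_triangle_x01 (R : realType) (q : R * R) :
  std_triangle q -> q != (0, 0) -> q != (1, 1) -> 0 < q.1 < 1.
Proof.
case: q => x y [/= h1 h2 h3] q0 q1; have x0 : x != 0.
  by apply: contra_neq q0 => x0; congr (_, _) => //; lra.
have x1 : x != 1.
  by apply: contra_neq q1 => x1; congr (_, _) => //; lra.
rewrite !lt_neqAle eq_sym x0 x1 /=; apply/andP; split; lra.
Qed.

Lemma above_chord (R : realType) (a q b : R * R) : a.1 < q.1 < b.1 ->
  (b.2 - q.2) * (q.1 - a.1) <= (q.2 - a.2) * (b.1 - q.1) ->
  exists t, [/\ 0 < t < 1, (t *: a + (1 - t) *: b).1 = q.1 &
    (t *: a + (1 - t) *: b).2 <= q.2].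
Proof.
move=> /andP[ai bi] Hab.
have d0 : b.1 - a.1 != 0 by rewrite gt_eqF//; lra.
pose t := (b.1 - q.1) / (b.1 - a.1).
have tE : t * (b.1 - a.1) = b.1 - q.1 by rewrite /t mulfVK.
have t0 : 0 < t by apply: divr_gt0; lra.
have t1 : t < 1 by rewrite ltr_pdivrMr; lra.
exists t; split; [by rewrite t0 t1|by rewrite /= /GRing.scale /=; lra|].
rewrite -(@ler_pM2r _ (b.1 - a.1)); last by lra.
have -> : (t *: a + (1 - t) *: b).2 * (b.1 - a.1) =
  t * (b.1 - a.1) * a.2 + (b.1 - a.1 - t * (b.1 - a.1)) * b.2.
  by rewrite /= /GRing.scale /=; ring.
by rewrite tE; lra.
Qed.

(** The number of vertices forces the points of [Y] and the two end vertices to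
be distinct and extreme. An extreme point lies below every chord spanning it, by
[vertex_lowest], which makes the slopes increase. Conversely a supporting line
exposes its point, and the end vertices are the extremes of the first
coordinate. *)
Lemma convex_chainE (R : realType) (Y : {fset R * R}) :
  (forall q, q \in Y -> std_triangle q) ->
  convex_chain (0, 0) (1, 1) Y <->
  cup (fun y : Y => val y) [set: Y]%SET.
Proof.
move=> YT; set A := [set` Y] `|` [set (0, 0); (1, 1)].
pose Y2 : {fset R * R} := ((0, 0) |` ((1, 1) |` Y))%fset.
have A0 : A (0, 0) by right; left.
have A1 : A (1, 1) by right; right.
have AE : A = [set` Y2].
  apply/seteqP; split => q /=.
    by move=> [/= qY|[->|->]]; rewrite !inE ?eqxx ?orbT// qY !orbT.
  rewrite !inE => /or3P[/eqP ->|/eqP ->|qY]//; by left.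
have vA := @vertices_hull R A.
split.
- rewrite /convex_chain -/A => cA.
  have fA : finite_set A by rewrite AE; exact: finite_fset.
  have cY : (#|` Y2| <= #|` Y| + 2)%N.
    rewrite /Y2 !cardfsU1 addnA addnC leq_add2l.
    exact: (leq_add (leq_b1 _) (leq_b1 _)).
  have VE : vertices (convex_hull A) = A.
    move: cA; rewrite AE => cA.
    have [V VE'] : exists V : {fset R * R}, vertices (convex_hull A) = [set` V].
      by apply/finite_fsetP; exact: sub_finite_set fA.
    rewrite AE in VE' vA; rewrite VE' in cA vA *.
    move/card_eq_fsetP : cA => cA.
    suff -> : V = Y2 by [].
    apply/eqP; rewrite eqEfcard cA cY andbT.
    by apply/fsubsetP => y /vA.
  have cY2 : #|` Y2| = (#|` Y| + 2)%N.
    by move: cA; rewrite VE AE => /card_eq_fsetP.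
  have [Y0 Y1] : (0, 0) \notin Y /\ (1, 1) \notin Y.
    move: cY2; rewrite /Y2 !cardfsU1 !inE.
    by case: ((0, 0) \in Y); case: ((1, 1) \in Y); rewrite ?orbT /=; lia.
  have x01 q : q \in Y -> 0 < q.1 < 1.
    move=> qY; apply: std_triangle_x01; first exact: YT.
      by apply: contraNneq Y0 => <-.
    by apply: contraNneq Y1 => <-.
  have low q u : q \in Y -> convex_hull A u -> u.1 = q.1 -> q.2 <= u.2.
    move=> qY; have [h1 h2 h3] := YT _ qY.
    apply: vertex_lowest => //; last exact: x01.
    by rewrite VE; left.
  have vY q : q \in Y -> vertices (convex_hull A) q by rewrite VE => ?; left.
  have CY q : q \in Y -> convex_hull A q by move=> /vY [].
  apply/cupP => i _; set q := val i; have qY : q \in Y by exact: valP.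
  split; [exact: YT|exact: x01| |].
  + move=> j _ ji; apply: contra_neq ji => xji; apply: val_inj.
    have jY : val j \in Y by exact: valP.
    rewrite [LHS]surjective_pairing [RHS]surjective_pairing xji; congr (_, _).
    by apply/le_anti/andP; split; apply: low => //; exact: CY.
  + move=> a b oa ob ai bi; rewrite ltNge; apply/negP => Hab.
    have hull_of c : [\/ c = (0, 0), c = (1, 1)
        | exists j : Y, [/\ j \in [set: Y]%SET, j != i & c = val j]] ->
        convex_hull A c.
      move=> [->|->|[j [_ _ ->]]]; [exact: sub_hull|exact: sub_hull|].
      by apply: CY; exact: valP.
    have [Ca Cb] := (hull_of _ oa, hull_of _ ob).
    have [|t [t01 u1 uq]] := @above_chord R a q b _ Hab; first by rewrite ai bi.
    have Cu : convex_hull A (t *: a + (1 - t) *: b).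
      by case/andP: (t01) => ? ?; apply: hull_convex => //; rewrite !ltW.
    have qu := low _ _ qY Cu u1.
    have E : q = t *: a + (1 - t) *: b.
      rewrite [LHS]surjective_pairing [RHS]surjective_pairing u1.
      by congr (_, _); apply/le_anti; rewrite qu uq.
    have [_ /(_ a b t Ca Cb t01 E) ab] := vY _ qY.
    by move: (lt_trans ai bi); rewrite ab ltxx.
- move=> cY.
  have x01 q : q \in Y -> 0 < q.1 < 1.
    by move=> qY; have := cup_x01 cY (finset.in_setT [` qY]%fset).
  have Y0 : (0, 0) \notin Y by apply/negP => /x01 /=; rewrite ltxx.
  have Y1 : (1, 1) \notin Y by apply/negP => /x01 /=; rewrite ltxx andbF.
  suff VA : vertices (convex_hull A) = A.
    rewrite /convex_chain -/A VA AE; apply/card_eq_fsetP.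
    rewrite /Y2 !cardfsU1 !inE negb_or Y0 Y1.
    have -> : ((0, 0) == (1, 1) :> R * R) = false.
      by apply/negbTE/eqP => -[/eqP]; rewrite eq_sym oner_eq0.
    by rewrite addn2.
  rewrite {Y2 AE}.
    apply/seteqP; split => // q [/= qY|[->|->]].
    + have [_ [s [s0 s1 sJ]]] := cY [` qY]%fset (finset.in_setT _).
      apply: (@exposed_vertex _ _ (- s) 1); first by left.
      rewrite /= in s0 s1 sJ.
      move=> r [/= rY|[->|->]] rq; [|rewrite /=; lra..].
      by have := sJ [` rY]%fset (finset.in_setT _) rq; rewrite /=; lra.
    + apply: (@exposed_vertex _ _ 1 0) => //.
      move=> r [/= rY|[->|->]]; rewrite ?eqxx//= => _; last lra.
      by have /andP[] := x01 _ rY; lra.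
    + apply: (@exposed_vertex _ _ (- 1) 0) => //.
      move=> r [/= rY|[->|->]]; rewrite ?eqxx//= => _; last lra.
      by have /andP[] := x01 _ rY; lra.
Qed.

(** Equal points may occur in the family, but not within a chain of
indices. *)
Lemma longest_chainE (R : realType) (n : nat) (z : 'I_n -> R * R) :
  (forall i, std_triangle (z i)) ->
  longest_chain (0, 0) (1, 1) [fset z i | i : 'I_n]%fset = longest_cup z.
Proof.
move=> zT; set S := [fset _ | _ in _]%fset.
have ST q : q \in S -> std_triangle q by move=> /imfsetP[i _ ->].
apply/eqP; rewrite eqn_leq; apply/andP; split.
  rewrite /longest_chain big_seq_cond; apply/bigmax_leqP_seq => Y.
  move=> _ /andP[+ /asboolP]; rewrite fpowersetE => /fsubsetP YS.
  move/(convex_chainE (fun q qY => ST _ (YS _ qY))) => cY.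
  have /choice[f fE] : forall y : Y, exists i, val y = z i.
    by move=> y; have /imfsetP[i _ ->] := YS _ (valP y); exists i.
  have fi : injective f.
    by move=> y y' ff; apply: val_inj; rewrite !fE ff.
  have /funext zf : z \o f =1 (fun y : Y => val y) by move=> y; rewrite /= fE.
  rewrite -zf in cY; move/(cup_reindex z (in2W fi)) : cY => /longest_cup_ge.
  by rewrite card_imset// cardsT -cardfE.
have [J cJ <-] := longest_cupP z.
pose Y := [fset z j | j in J]%fset.
have cY : #|` Y| = #|J|.
  by rewrite card_in_imfset ?cardE//=; exact: cup_inj.
have YS : (Y `<=` S)%fset.
  by apply/fsubsetP => q /imfsetP[j _ ->]; apply/imfsetP; exists j.
have /choice[f fE] : forall y : Y, exists i, i \in J /\ val y = z i.
  by move=> y; have /imfsetP[i iJ ->] := valP y; exists i.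
have fi : injective f.
  by move=> y y' ff; apply: val_inj; rewrite !(fE _).2 ff.
rewrite -cY /longest_chain; apply: leq_bigmax_seq.
  by rewrite fpowersetE.
apply/asboolP/convex_chainE; first by move=> q /(fsubsetP YS); exact: ST.
have /funext <- : z \o f =1 (fun y : Y => val y) by move=> y; rewrite /= (fE _).2.
apply/(cup_reindex z (in2W fi)); apply: cup_sub cJ.
by apply/fintype.subsetP => _ /imsetP[y _ ->]; exact: (fE _).1.
Qed.

(** * Chains along the parabola *)

(** The affine map taking the arc of the parabola [y = x ^ 2] over
[[i / k, (i + 1) / k]] to the arc over [[0, 1]], hence the triangle formed by
its chord and its end tangents to the standard triangle. *)
Definition zoom (R : realType) (k i : nat) (q : R * R) : R * R :=
  (k%:R * q.1 - i%:R,
   k%:R ^+ 2 * q.2 - 2 * i%:R * k%:R * q.1 + i%:R ^+ 2).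

Lemma zoom_std_triangle (R : realType) k i (q : R * R) : (i < k)%N ->
  std_triangle (zoom k i q) -> std_triangle q.
Proof.
case: q => x y ik; rewrite /std_triangle /zoom /=.
have i0 : 0 <= i%:R :> R by [].
have {}ik : i%:R + 1 <= k%:R :> R by rewrite natr1 ler_nat.
set a : R := i%:R in i0 ik *; set K : R := k%:R in ik *.
set X := K * x - a; set Y := _ + _ => -[h1 h2 h3].
have X0 : 0 <= X by lra.
have X1 : X <= 1 by lra.
have K0 : 0 < K by lra.
have Ex : K * x = X + a by rewrite /X; lra.
have Ey : K ^+ 2 * y = Y + 2 * a * X + a ^+ 2 by rewrite /Y /X; ring.
have K2 : 0 < K ^+ 2 by rewrite exprn_gt0.
split.
- by rewrite -(pmulr_rge0 _ K2) Ey; nra.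
- rewrite -(ler_pM2l K2) Ey.
  have -> : K ^+ 2 * (2 * x - 1) = K * (2 * (K * x) - K) by ring.
  by rewrite Ex; nra.
- rewrite -(ler_pM2l K2) Ey.
  have -> : K ^+ 2 * x = K * (K * x) by ring.
  by rewrite Ex; nra.
Qed.

(** Chains in the triangles along the parabola fit together: each triangle
lies above the tangents at the ends of every other arc, and a line supporting a
chain in one triangle separates it strictly from the ends of its arc, so it
stays below all the other triangles. *)
Lemma longest_cup_superadditive (R : realType) (I : finType) (z : I -> R * R)
    (k : nat) :
  (\sum_(i < k) longest_cup (zoom k i \o z) <= longest_cup z)%N.
Proof.
have /choice[J JP] : forall i : 'I_k, exists J : {set I},
    cup (zoom k i \o z) J /\ #|J| = longest_cup (zoom k i \o z).
  by move=> i; have [J cJ cE] := longest_cupP (zoom k i \o z); exists J.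
have disj i j : i != j -> [disjoint J i & J j]%B.
  move=> ij; apply/pred0P => a; apply/negbTE/negP => /andP[/= ai aj].
  have /andP[] := cup_x01 (JP i).1 ai; have /andP[] := cup_x01 (JP j).1 aj.
  rewrite /= => j0 j1 i0 i1.
  have : i%:R < j%:R + 1 :> R by lra.
  have : j%:R < i%:R + 1 :> R by lra.
  rewrite !natr1 !ltr_nat !ltnS => h1 h2; move/negP: ij; apply.
  by apply/eqP/val_inj/eqP; rewrite eqn_leq h1 h2.
have -> : (\sum_(i < k) longest_cup (zoom k i \o z))%N = #|\bigcup_i J i|%SET.
  rewrite -sum1_card (partition_disjoint_bigcup _ _ disj).
  by apply: eq_bigr => i _; rewrite sum1_card (JP i).2.
apply: longest_cup_ge => a /bigcupP[i _ ai].
have [Ta [s [s0 s1 sJ]]] := (JP i).1 _ ai.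
have x01 := cup_x01 (JP i).1 ai.
rewrite /= in s0 s1 sJ x01 Ta.
split; first exact: zoom_std_triangle Ta.
case: Ta => /= h1 h2 h3.
have i0 : 0 <= i%:R :> R by [].
have ik : i%:R + 1 <= k%:R :> R by rewrite natr1 ler_nat.
set ai' : R := i%:R in h1 h2 h3 s0 s1 sJ x01 i0 ik *.
set K : R := k%:R in h1 h2 h3 s0 s1 sJ x01 ik *.
have K0 : 0 < K by lra.
have K2 : 0 < K ^+ 2 by rewrite exprn_gt0.
pose X (r : R * R) := K * r.1 - ai'.
pose Y (r : R * R) := K ^+ 2 * r.2 - 2 * ai' * K * r.1 + ai' ^+ 2.
rewrite -/(X (z a)) -/(Y (z a)) in h1 h2 h3 s0 s1 sJ x01.
move/andP: x01 => [x0 x1].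
have sp : 0 < s by nra.
have s2 : s < 2 by nra.
(* the slope of the image under the inverse zoom of a line of slope [s] *)
pose t := (s + 2 * ai') / K.
have tE : t * K = s + 2 * ai' by rewrite /t mulfVK// gt_eqF.
have key (r : R * R) : Y (z a) + s * (X r - X (z a)) < Y r ->
    (z a).2 + t * (r.1 - (z a).1) < r.2.
  move=> H; rewrite -(ltr_pM2l K2).
  have -> : K ^+ 2 * ((z a).2 + t * (r.1 - (z a).1)) =
    K ^+ 2 * (z a).2 + t * K * (K * r.1 - K * (z a).1) by ring.
  rewrite tE; move: H; rewrite /X /Y; nra.
have right_of (r : R * R) : 1 <= X r -> 2 * X r - 1 <= Y r ->
    Y (z a) + s * (X r - X (z a)) < Y r by nra.
have left_of (r : R * R) : X r <= 0 -> 0 <= Y r ->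
    Y (z a) + s * (X r - X (z a)) < Y r by nra.
exists t; split.
- have := key (0, 0); rewrite /= sub0r mulrN; apply; apply: left_of;
  by rewrite /X /Y /=; nra.
- by have := key (1, 1); rewrite /=; apply; apply: right_of;
  rewrite /X /Y /=; nra.
- move=> b /bigcupP[l _ bl] ba; apply: key.
  have [li|li] := eqVneq l i; first by rewrite li in bl; exact: sJ.
  have [[/= g1 g2 g3] _] := (JP l).1 _ bl.
  have /andP[/= y0 y1] := cup_x01 (JP l).1 bl.
  rewrite -/K in g1 g2 g3 y0 y1; set c : R := l%:R in g1 g2 g3 y0 y1.
  have Xb : K * (z b).1 = X (z b) + ai' by rewrite /X; lra.
  have Yb : K ^+ 2 * (z b).2 = Y (z b) + 2 * ai' * (X (z b) + ai') - ai' ^+ 2.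
    by rewrite -Xb /Y; ring.
  have Ec : 2 * c * K * (z b).1 = 2 * c * (X (z b) + ai') by rewrite -Xb; ring.
  rewrite Ec ?Xb Yb in g1 g2 g3 y0 y1.
  have : (l < i)%N \/ (i < l)%N by apply/orP; rewrite -neq_ltn.
  move=> [ll|ll].
    have {}ll : c + 1 <= ai' by rewrite natr1 ler_nat.
    by apply: left_of; nra.
  have {}ll : ai' + 1 <= c by rewrite natr1 ler_nat.
  by apply: right_of; nra.
Qed.

(** * Area under affine maps *)

Lemma lebesgue_measure_affine (R : realType) (a t : R) (A : set R) : a != 0 ->
  measurable A ->
  lebesgue_measure ((fun x => a * x + t) @^-1` A) =
  (`|a|^-1%:E * lebesgue_measure A)%E.
Proof.
move=> a0 mA; set f := fun x => _.
have mf : measurable_fun [set: R] f.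
  by apply: measurable_funD => //; exact: measurable_funM.
pose mu : {measure set (measurableTypeR R) -> \bar R} :=
  mscale (NngNum (normr_ge0 a))
    (pushforward lebesgue_measure (f : _ -> measurableTypeR R)).
suff -> : lebesgue_measure A = mu mf A.
  by rewrite /mu /= /mscale /= muleA -EFinM mulVf ?mul1e// normr_eq0.
apply: lebesgue_measure_unique => // _ [[u v] /= _ <-].
rewrite /mu /= /mscale /= /pushforward.
have [a_gt0|a_lt0|a_eq0] := ltrgt0P a; last by rewrite a_eq0 eqxx in a0.
- have -> : f @^-1` `]u, v] = `](u - t) / a, (v - t) / a]%classic.
    apply/seteqP; split => x; rewrite /f /= !in_itv /=.
      by rewrite ltr_pdivrMr// ler_pdivlMr// ltrBlDr lerBrDr mulrC.
    by rewrite ltr_pdivrMr// ler_pdivlMr// ltrBlDr lerBrDr mulrC.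
  rewrite !lebesgue_measure_itv /= !lte_fin ltr_pM2r ?invr_gt0// ltrD2r.
  case: ifP => _; last by rewrite mule0.
  by rewrite -!EFinB -EFinM; congr EFin; field.
- have -> : f @^-1` `]u, v] = `[(v - t) / a, (u - t) / a[%classic.
    apply/seteqP; split => x; rewrite /f /= !in_itv /=.
      by rewrite ltr_ndivlMr// ler_ndivrMr// ltrBlDr lerBrDr mulrC andbC.
    by rewrite ltr_ndivlMr// ler_ndivrMr// ltrBlDr lerBrDr mulrC andbC.
  rewrite !lebesgue_measure_itv /= !lte_fin ltr_nM2r ?invr_lt0// ltrD2r.
  case: ifP => _; last by rewrite mule0.
  by rewrite -!EFinB -EFinM; congr EFin; field.
Qed.

Lemma area_unique (R : realType) (mu : {measure set (R * R)%type -> \bar R}) :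
  (forall B C : set R, measurable B -> measurable C ->
    mu (B `*` C) = (lebesgue_measure B * lebesgue_measure C)%E) ->
  forall A, measurable A -> area A = mu A.
Proof.
move=> H A mA.
(* The identity transports [mu] to the copy of the plane that carries the
   product of Lebesgue measures. *)
pose T := (measurableTypeR R * measurableTypeR R)%type.
have mid : measurable_fun [set: R * R] (idfun : (R * R)%type -> T).
  by move=> _ B mB; rewrite setTI.
pose mu' : {measure set T -> \bar R} :=
  pushforward mu (idfun : (R * R)%type -> T).
have H' (B C : set (measurableTypeR R)) : measurable B -> measurable C ->
    mu' mid (B `*` C) = (lebesgue_measure B * lebesgue_measure C)%E.
  by move=> mB mC; exact: H.
exact: (@product_measure_unique _ _ _ _ R
  (@lebesgue_measure R) (@lebesgue_measure R) (mu' mid) H' A mA).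
Qed.

Definition scales_area (R : realType) (f : R * R -> R * R) (c : R) : Prop :=
  measurable_fun setT f /\
  forall A, measurable A -> area (f @^-1` A) = (c%:E * area A)%E.

Lemma scales_area_comp (R : realType) (f g : R * R -> R * R) (c e : R) :
  scales_area f c -> scales_area g e -> scales_area (g \o f) (c * e).
Proof.
move=> [mf fE] [mg gE]; split; first exact: measurableT_comp.
move=> A mA; rewrite comp_preimage fE ?gE ?EFinM ?muleA//.
by rewrite -[X in measurable X]setTI; exact: mg.
Qed.

(** A shear translates each vertical section. *)
Lemma scales_area_shear (R : realType) (c : R) :
  scales_area (fun q => (q.1, q.2 + c * q.1)) 1.
Proof.
have mf : measurable_fun [set: R * R] (fun q => (q.1, q.2 + c * q.1)).
  apply/measurable_fun_pair => //.
  by apply: measurable_funD => //; exact: measurable_funM.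
split=> // A mA; rewrite mul1e /area /product_measure1.
apply: eq_integral => x _ /=.
have mx := measurable_xsection x mA.
have := @lebesgue_measure_affine R 1 (c * x) _ (oner_neq0 _) mx.
rewrite normr1 invr1 mul1e => <-; congr (lebesgue_measure _).
by apply/seteqP; split => y; rewrite /xsection /= !inE /= mul1r.
Qed.

Lemma scales_area_prod (R : realType) (a s b t : R) : a != 0 -> b != 0 ->
  scales_area (fun q => (a * q.1 + s, b * q.2 + t)) (`|a|^-1 * `|b|^-1).
Proof.
move=> a0 b0; set f := fun q => _.
have mf : measurable_fun [set: R * R] f.
  apply/measurable_fun_pair => //=.
    by apply: measurable_funD => //; exact: measurable_funM.
  by apply: measurable_funD => //; exact: measurable_funM.
split=> // A mA; have ab0 : 0 <= `|a| * `|b| by rewrite mulr_ge0.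
pose mu : {measure set (R * R)%type -> \bar R} :=
  mscale (NngNum ab0) (pushforward (lebesgue_measure \x lebesgue_measure)%E
    (f : (R * R)%type -> (R * R)%type)).
suff -> : area A = mu mf A.
  rewrite /mu /= /mscale /= muleA -EFinM -invfM mulVf ?mul1e//.
  by rewrite mulf_neq0// normr_eq0.
apply: (area_unique (mu := mu mf)) => // B C mB mC.
rewrite /mu /= /mscale /= /pushforward.
have mB' : measurable ((fun x => a * x + s) @^-1` B).
  rewrite -[X in measurable X]setTI.
  by apply: measurable_funD => //; exact: measurable_funM.
have mC' : measurable ((fun x => b * x + t) @^-1` C).
  rewrite -[X in measurable X]setTI.
  by apply: measurable_funD => //; exact: measurable_funM.
have -> : f @^-1` (B `*` C) =
    ((fun x => a * x + s) @^-1` B) `*` ((fun x => b * x + t) @^-1` C) by [].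
rewrite /area product_measure1E//= !lebesgue_measure_affine//.
set x := lebesgue_measure B; set y := lebesgue_measure C.
rewrite (muleACA (`|a|^-1)%:E x) [LHS]muleA EFinM (muleACA `|a|%:E `|b|%:E).
by rewrite -(EFinM `|a|) -(EFinM `|b|) !mulfV ?normr_eq0// !mul1e.
Qed.

Lemma scales_area_swap (R : realType) : scales_area (fun q : R * R => (q.2, q.1)) 1.
Proof.
set f := fun q : R * R => _.
have mf : measurable_fun [set: R * R] f by exact/measurable_fun_pair.
split=> // A mA; rewrite mul1e.
pose mu : {measure set (R * R)%type -> \bar R} :=
  pushforward (lebesgue_measure \x lebesgue_measure)%E f.
suff -> : area A = mu mf A by [].
apply: (area_unique (mu := mu mf)) => // B C mB mC.
rewrite /mu /= /pushforward.
have -> : f @^-1` (B `*` C) = C `*` B.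
  by apply/seteqP; split => -[x y] [].
by rewrite /area product_measure1E//= muleC.
Qed.

Lemma scales_area_zoom (R : realType) (k i : nat) : (0 < k)%N ->
  scales_area (@zoom R k i) (k%:R ^+ 3)^-1.
Proof.
move=> k0; have k0' : k%:R != 0 :> R by rewrite pnatr_eq0 -lt0n.
have := scales_area_comp
  (scales_area_prod (- i%:R) (- i%:R ^+ 2) k0' (expf_neq0 2 k0'))
  (scales_area_shear (- (2 * i%:R))).
rewrite mulr1 normrX normr_nat -invfM -exprS.
congr scales_area; apply/funext => -[x y].
by rewrite /zoom /=; congr (_, _); ring.
Qed.

Definition frame (R : realType) (p u v q : R * R) : R * R :=
  p + q.1 *: u + q.2 *: v.

(** Gaussian elimination writes a matrix whose pivot is nonzero as a product of
shears and a diagonal matrix; a vanishing pivot calls for a swap of the axes. *)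
Lemma scales_area_frame (R : realType) (p u v : R * R) :
  u.1 * v.2 - u.2 * v.1 != 0 -> exists2 c, 0 < c & scales_area (frame p u v) c.
Proof.
suff main (p' u' v' : R * R) : u'.1 != 0 -> u'.1 * v'.2 - u'.2 * v'.1 != 0 ->
    exists2 c, 0 < c & scales_area (frame p' u' v') c.
  have [u0|u0] := eqVneq u.1 0; last exact: main.
  move=> d0; have [||c c0 sc] := main p v u.
  - by apply: contraNneq d0 => ->; rewrite u0 mul0r mulr0 subrr.
  - by apply: contraNneq d0; rewrite u0; lra.
  exists (1 * c); first by rewrite mul1r.
  have := scales_area_comp (scales_area_swap R) sc; congr scales_area.
  by apply/funext => q; rewrite /frame /= addrAC.
move: p' u' v' => {u v}p u v u0 d0.
pose d := v.2 - u.2 * v.1 / u.1.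
have dn : d != 0.
  apply: contraNneq d0 => E; have : d * u.1 = 0 by rewrite E mul0r.
  by rewrite /d mulrBl mulfVK// mulrC => ->.
have sw := scales_area_swap R.
have := scales_area_comp (scales_area_comp (scales_area_comp
    (scales_area_comp sw (scales_area_shear (v.1 / u.1))) sw)
  (scales_area_prod 0 0 u0 dn))
  (scales_area_comp (scales_area_shear (u.2 / u.1))
    (scales_area_prod p.1 p.2 (oner_neq0 R) (oner_neq0 R))).
set c := (X in scales_area _ X); set g := (X in scales_area X _).
have -> : g = frame p u v.
  apply/funext => q; rewrite /g /frame /d [RHS]surjective_pairing.
  by congr (_, _); rewrite /= /GRing.scale /=; field.
move=> H; exists c => //; rewrite /c.
by rewrite !mulr_gt0 ?invr_gt0 ?normr_gt0// oner_neq0.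
Qed.

(** * Affine invariance of convex chains *)

Definition affine (R : realType) (f : R * R -> R * R) : Prop :=
  forall x y (t : R), f (t *: x + (1 - t) *: y) = t *: f x + (1 - t) *: f y.

Lemma hull_affine (R : realType) (f : R * R -> R * R) (A : set (R * R)) :
  affine f -> convex_hull (f @` A) = f @` convex_hull A.
Proof.
move=> af; apply/seteqP; split.
  apply: hull_min => [_ _ t [x Ax <-] [y Ay <-] t01|_ [x Ax <-]].
    by exists (t *: x + (1 - t) *: y); [exact: hull_convex|exact: af].
  by exists x => //; exact: sub_hull.
move=> _ [x + <-]; move: x; apply: hull_min => [x y t Hx Hy t01|x Ax].
  by rewrite af; exact: hull_convex.
by apply: sub_hull; exists x.
Qed.

Lemma vertices_affine (R : realType) (f : R * R -> R * R) (C : set (R * R)) :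
  affine f -> injective f -> vertices (f @` C) = f @` vertices C.
Proof.
move=> af fi; apply/seteqP; split.
  move=> _ [[x Cx <-] ex]; exists x => //; split=> // y z t Cy Cz t01 E.
  apply: fi; apply: (ex (f y) (f z) t); [by exists y|by exists z|by []|].
  by rewrite E af.
move=> _ [x [Cx ex] <-]; split; first by exists x.
move=> _ _ t [y Cy <-] [z Cz <-] t01 E; congr f.
by apply: (ex _ _ t) => //; apply: fi; rewrite E af.
Qed.

Lemma convex_chain_affine (R : realType) (f : R * R -> R * R) p0 p2
    (Y : {fset R * R}) :
  affine f -> injective f ->
  convex_chain (f p0) (f p2) [fset f y | y in Y]%fset <-> convex_chain p0 p2 Y.
Proof.
move=> af fi; rewrite /convex_chain.
have -> : [set` [fset f y | y in Y]%fset] `|` [set f p0; f p2] =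
    f @` ([set` Y] `|` [set p0; p2]).
  apply/seteqP; split=> [_ [/= /imfsetP[y /= yY ->]|[->|->]]|
                         _ [y [/= yY|[->|->]] <-]].
  - by exists y => //; left.
  - by exists p0 => //; right; left.
  - by exists p2 => //; right; right.
  - by left; apply/imfsetP; exists y.
  - by right; left.
  - by right; right.
rewrite hull_affine// vertices_affine// card_imfset//=.
by rewrite (card_eql (inj_card_eq (in2W fi))).
Qed.

Lemma longest_chain_affine (R : realType) (f : R * R -> R * R) p0 p2
    (S : {fset R * R}) :
  affine f -> injective f ->
  longest_chain (f p0) (f p2) [fset f y | y in S]%fset = longest_chain p0 p2 S.
Proof.
move=> af fi; apply/eqP; rewrite eqn_leq; apply/andP; split.
  rewrite {1}/longest_chain big_seq_cond; apply/bigmax_leqP_seq => Y'.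
  move=> _ /andP[+ /asboolP]; rewrite fpowersetE => /fsubsetP YS.
  pose Y := [fset y in S | f y \in Y']%fset.
  have -> : Y' = [fset f y | y in Y]%fset.
    apply/fsetP => y'; apply/idP/imfsetP => [yY|[y /=]].
      have /imfsetP[y /= yS E] := YS _ yY; exists y => //.
      by rewrite !inE yS -E.
    by rewrite !inE => /andP[_ fy] ->.
  move/(convex_chain_affine _ _ _ af fi) => cY; rewrite card_imfset//=.
  apply: leq_bigmax_seq; last exact/asboolP.
  by rewrite fpowersetE; apply/fsubsetP => y; rewrite !inE => /andP[].
rewrite {1}/longest_chain big_seq_cond; apply/bigmax_leqP_seq => Y.
move=> _ /andP[+ /asboolP]; rewrite fpowersetE => /fsubsetP YS.
move/(convex_chain_affine _ _ _ af fi) => cY.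
have <- : #|` [fset f y | y in Y]%fset| = #|` Y| by rewrite card_imfset.
apply: leq_bigmax_seq; last exact/asboolP.
rewrite fpowersetE; apply/fsubsetP => _ /imfsetP[y /= yY ->].
by apply/imfsetP; exists y => //=; exact: YS.
Qed.

Lemma frame_affine (R : realType) (p u v : R * R) : affine (frame p u v).
Proof.
move=> x y t; rewrite /frame [LHS]surjective_pairing [RHS]surjective_pairing.
by congr (_, _); rewrite /= /GRing.scale /=; ring.
Qed.

Lemma frame_inv (R : realType) (p u v : R * R) :
  u.1 * v.2 - u.2 * v.1 != 0 -> exists p' u' v',
  [/\ u'.1 * v'.2 - u'.2 * v'.1 != 0,
    cancel (frame p u v) (frame p' u' v') &
    cancel (frame p' u' v') (frame p u v)].
Proof.
set D := _ - _ => D0.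
pose u' := (v.2 / D, - u.2 / D); pose v' := (- v.1 / D, u.1 / D).
exists (- (p.1 *: u' + p.2 *: v')), u', v'; split.
- have -> : u'.1 * v'.2 - u'.2 * v'.1 = D^-1 by rewrite /= /D; field.
  by rewrite invr_eq0.
- move=> q; rewrite /frame [LHS]surjective_pairing [RHS]surjective_pairing.
  by congr (_, _); rewrite /= /GRing.scale /= /D; field.
- move=> q; rewrite /frame [LHS]surjective_pairing [RHS]surjective_pairing.
  by congr (_, _); rewrite /= /GRing.scale /= /D; field.
Qed.

Lemma triangle_frame (R : realType) (p0 p1 p2 : R * R) :
  nondegenerate_triangle p0 p1 p2 -> exists u v,
  [/\ u.1 * v.2 - u.2 * v.1 != 0, frame p0 u v (0, 0) = p0,
    frame p0 u v (1, 1) = p2 &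
    triangle p0 p1 p2 = frame p0 u v @` @std_triangle R].
Proof.
move=> nd; pose U := p1 - p0; pose V := p2 - p0.
(* The middle vertex of the standard triangle is [(1 / 2, 0)], whence the
   factor 2. *)
pose u := 2 *: U; pose v := V - u; exists u, v.
have f0 : frame p0 u v (0, 0) = p0 by rewrite /frame /= !scale0r !addr0.
have f1 : frame p0 u v (2^-1, 0) = p1.
  rewrite /frame /= scale0r addr0 /u scalerA mulVf// scale1r.
  by rewrite /U addrC subrK.
have f2 : frame p0 u v (1, 1) = p2.
  by rewrite /frame /= !scale1r -addrA /v [u + _]addrC subrK /V addrC subrK.
split=> //; last first.
  rewrite -triangleE -hull_affine; last exact: frame_affine.
  congr convex_hull; apply/seteqP; split=> [_ [[->|->]|->]|_ [q [[->|->]|->] <-]].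
  - by exists (0, 0) => //; left; left.
  - by exists (2^-1, 0) => //; left; right.
  - by exists (1, 1) => //; right.
  - by left; left.
  - by left; right.
  - by right.
have -> : u.1 * v.2 - u.2 * v.1 = 2 * (U.1 * V.2 - U.2 * V.1).
  by rewrite /v /u /= /GRing.scale /=; ring.
rewrite mulf_neq0//; apply/negP => /eqP D0.
have [V2 /eqP] : V.2 = 0 /\ - U.2 = 0.
  by apply: nd; rewrite [LHS]surjective_pairing;
    congr (_, _); rewrite /= /GRing.scale /= -/U -/V in D0 *;
    move: D0 => /=; lra.
rewrite oppr_eq0 => /eqP U2.
have [V1 /eqP] : V.1 = 0 /\ - U.1 = 0.
  by apply: nd; rewrite [LHS]surjective_pairing;
    congr (_, _); rewrite /= /GRing.scale /= -/U -/V in D0 *;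
    move: D0 => /=; lra.
rewrite oppr_eq0 => /eqP U1.
have [/eqP] : 1 = 0 :> R /\ 0 = 0 :> R.
  apply: nd; rewrite scale1r scale0r addr0 -/U [LHS]surjective_pairing.
  by rewrite U1 U2.
by rewrite oner_eq0.
Qed.

(** * The law of the longest chain *)

(** The boxes are stable under intersection and generate the product
sigma-algebra. *)
Lemma box_law_unique (R : realType) d (E : measurableType d) n
    (m1 m2 : {measure set (n.-tuple E) -> \bar R}) :
  (m1 setT < +oo)%E ->
  (forall A : 'I_n -> set E, (forall i, measurable (A i)) ->
    m1 [set t | forall i, A i (tnth t i)] =
    m2 [set t | forall i, A i (tnth t i)]) ->
  forall B, measurable B -> m1 B = m2 B.
Proof.
move=> m1oo H B mB.
pose G := [set C : set (n.-tuple E) | exists2 A : 'I_n -> set E,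
  (forall i, measurable (A i)) & C = [set t | forall i, A i (tnth t i)]].
have GT : G setT by exists (fun _ => setT) => //; apply/seteqP; split.
have mG : G `<=` measurable.
  move=> _ [A mA ->].
  rewrite (_ : mkset _ = \bigcap_(i in [set: 'I_n]) ((@tnth n E)^~ i @^-1` A i)).
    apply: fin_bigcap_measurable => // i _.
    by rewrite -[X in measurable X]setTI; exact: measurable_tnth.
  by apply/seteqP; split=> t /= Ht i; [move=> _; exact: Ht|exact: Ht].
apply: (measure_unique G (fun _ => setT)) => //.
- apply/seteqP; split; last first.
    by apply: smallest_sub => //; exact: sigma_algebra_measurable.
  apply: smallest_sub; first exact: smallest_sigma_algebra.
  move=> C; rewrite -bigcup_seq => -[i _ [D mD <-]].
  apply: sub_sigma_algebra.
  exists (fun j => if j == i then D else setT).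
    by move=> j; case: ifP.
  rewrite setTI; apply/seteqP; split=> t /=.
    by move=> Dt j; case: ifP => // /eqP ->.
  by move=> /(_ i); rewrite eqxx.
- move=> _ _ [A mA ->] [A' mA' ->]; exists (fun i => A i `&` A' i).
    by move=> i; exact: measurableI.
  apply/seteqP; split=> t /=; first by move=> [h1 h2] i; split.
  by move=> h; split=> i; have [] := h i.
- by apply/seteqP; split=> // t _; exists 0%N.
- by move=> _ [A mA ->]; exact: H.
Qed.

Section law.
Context (R : realType) d (E : measurableType d) (n : nat).
Context d1 (O1 : measurableType d1) d2 (O2 : measurableType d2).
Variables (mu1 : {finite_measure set O1 -> \bar R}).
Variables (mu2 : {measure set O2 -> \bar R}) (c : {nonneg R}).
Variables (X1 : 'I_n -> O1 -> E) (X2 : 'I_n -> O2 -> E).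
Hypotheses (mX1 : forall i, measurable_fun setT (X1 i))
  (mX2 : forall i, measurable_fun setT (X2 i)).

(** The factor [c] is the probability of an event, when [mu1] is the
restriction of a probability to it and [mu2] has the conditional law. *)
Lemma integral_law (h : n.-tuple E -> \bar R) :
  (forall A : 'I_n -> set E, (forall i, measurable (A i)) ->
    mu1 [set w | forall i, A i (X1 i w)] =
    (c%:num%:E * mu2 [set w | forall i, A i (X2 i w)])%E) ->
  measurable_fun setT h -> (forall t, 0 <= h t)%E ->
  (\int[mu1]_w h [tuple X1 i w | i < n] =
   c%:num%:E * \int[mu2]_w h [tuple X2 i w | i < n])%E.
Proof.
move=> XX mh h0.
pose Y1 w := [tuple X1 i w | i < n]; pose Y2 w := [tuple X2 i w | i < n].
have mY1 : measurable_fun [set: O1] (Y1 : O1 -> n.-tuple E).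
  apply/measurable_fun_tnthP => i; rewrite (_ : _ \o _ = X1 i)//.
  by apply/funext => w; rewrite /= tnth_mktuple.
have mY2 : measurable_fun [set: O2] (Y2 : O2 -> n.-tuple E).
  apply/measurable_fun_tnthP => i; rewrite (_ : _ \o _ = X2 i)//.
  by apply/funext => w; rewrite /= tnth_mktuple.
pose m1 : {measure set (n.-tuple E) -> \bar R} := pushforward mu1 Y1.
pose m2 : {measure set (n.-tuple E) -> \bar R} := mscale c (pushforward mu2 Y2).
have E1 := @ge0_integral_pushforward _ _ _ _ R _ mY1 mu1 setT h measurableT mh
  (fun y _ => h0 y).
have E2 := @ge0_integral_pushforward _ _ _ _ R _ mY2 mu2 setT h measurableT mh
  (fun y _ => h0 y).
rewrite !preimage_setT in E1 E2; rewrite -[LHS]E1 -[X in (_ * X)%E]E2.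
rewrite -(ge0_integral_mscale _ _ c)//.
apply: (@eq_measure_integral _ _ _ _ (m2 mY2) (m1 mY1)) => A mA _.
apply: box_law_unique => //.
  by rewrite /m1 /= /pushforward preimage_setT; exact: fin_num_fun_lty.
move=> B mB; rewrite /m1 /m2 /= /mscale /= /pushforward.
have -> : Y1 @^-1` [set t | forall i, B i (tnth t i)] =
    [set w | forall i, B i (X1 i w)].
  by apply/seteqP; split=> w /= H i; have := H i; rewrite tnth_mktuple.
rewrite XX//; congr (_ * mu2 _)%E.
by apply/seteqP; split=> w /= H i; have := H i; rewrite tnth_mktuple.
Qed.

End law.

Section measurability.
Context (R : realType) d (T : measurableType d).

Lemma measurable_lt (f g : T -> R) : measurable_fun setT f ->
  measurable_fun setT g -> measurable [set t | f t < g t].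
Proof.
move=> mf mg; rewrite -[X in measurable X]setTI.
have := measurable_fun_ltr mf mg; move/(_ measurableT [set true]); exact.
Qed.

Lemma measurable_le (f g : T -> R) : measurable_fun setT f ->
  measurable_fun setT g -> measurable [set t | f t <= g t].
Proof.
move=> mf mg; rewrite (_ : mkset _ = ~` [set t | g t < f t]).
  by apply: measurableC; exact: measurable_lt.
by apply/seteqP; split=> t /=; rewrite leNgt => /negP.
Qed.

Lemma measurable_forall (I : finType) (A : I -> set T) :
  (forall i, measurable (A i)) -> measurable [set t | forall i, A i t].
Proof.
move=> mA; rewrite (_ : mkset _ = \bigcap_(i in [set: I]) A i).
  exact: fin_bigcap_measurable.
by apply/seteqP; split=> t /= Ht i; [move=> _|]; exact: Ht.
Qed.

Lemma measurable_exists (I : finType) (A : I -> set T) :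
  (forall i, measurable (A i)) -> measurable [set t | exists i, A i t].
Proof.
move=> mA; rewrite (_ : mkset _ = \bigcup_(i in [set: I]) A i).
  exact: fin_bigcup_measurable.
by apply/seteqP; split=> t /= [i]; [exists i|move=> _; exists i].
Qed.

Lemma measurable_imply (P : Prop) (A : set T) :
  (P -> measurable A) -> measurable [set t | P -> A t].
Proof.
have [p|np] := pselect P => mA.
  by rewrite (_ : mkset _ = A); [exact: mA|apply/seteqP; split=> t /=; auto].
by rewrite (_ : mkset _ = setT)//; apply/seteqP; split=> t // _ /np.
Qed.

Lemma measurable_slopes (a q b : T -> R * R) : measurable_fun setT a ->
  measurable_fun setT q -> measurable_fun setT b ->
  measurable [set t | slopes_increase (a t) (q t) (b t)].
Proof.
move=> ma mq mb.
have m1 (f : T -> R * R) : measurable_fun setT f ->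
    measurable_fun setT (fun t => (f t).1).
  by move=> mf; exact: (measurableT_comp measurable_fst mf).
have m2 (f : T -> R * R) : measurable_fun setT f ->
    measurable_fun setT (fun t => (f t).2).
  by move=> mf; exact: (measurableT_comp measurable_snd mf).
have mB (f g : T -> R) : measurable_fun setT f -> measurable_fun setT g ->
    measurable_fun setT (fun t => f t - g t).
  by move=> mf mg; exact: measurable_funB.
rewrite (_ : mkset _ = ~` [set t | (a t).1 < (q t).1] `|`
  (~` [set t | (q t).1 < (b t).1] `|`
   [set t | ((q t).2 - (a t).2) * ((b t).1 - (q t).1) <
            ((b t).2 - (q t).2) * ((q t).1 - (a t).1)])).
  apply: measurableU; first by apply/measurableC/measurable_lt; exact: m1.
  apply: measurableU; first by apply/measurableC/measurable_lt; exact: m1.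
  by apply: measurable_lt; apply: measurable_funM; apply: mB;
    (exact: m1 || exact: m2).
apply/seteqP; split=> t /=; rewrite /slopes_increase /=.
  case: ltP => [h1|]; last by left.
  by case: ltP => [h2 /(_ isT isT)|]; [right; right|right; left].
by move=> [n1 /n1|[n2 _ /n2|h _ _]].
Qed.

(** By [cupP], finitely many polynomial inequalities between coordinates. *)
Lemma measurable_cup (I : finType) (z : T -> I -> R * R) (J : {set I}) :
  (forall i, measurable_fun setT (fun t => z t i)) ->
  measurable [set t | cup (z t) J].
Proof.
move=> mz.
have m1 i : measurable_fun setT (fun t => (z t i).1).
  exact: (measurableT_comp measurable_fst (mz i)).
have m2 i : measurable_fun setT (fun t => (z t i).2).
  exact: (measurableT_comp measurable_snd (mz i)).
have mc (r : R) : measurable_fun setT (fun _ : T => r) by exact: measurable_cst.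
pose pt (t : T) (k : I + bool) : R * R :=
  match k with inl j => z t j | inr b => if b then (1, 1) else (0, 0) end.
have mpt k : measurable_fun setT (fun t => pt t k).
  by case: k => [j|[]] //=; exact: measurable_cst.
pose valid (i : I) (k : I + bool) :=
  if k is inl j then (j \in J) && (j != i) else true.
rewrite (_ : mkset _ = [set t | forall i, i \in J ->
   (([set t | 0 <= (z t i).2] `&` [set t | 2 * (z t i).1 - 1 <= (z t i).2] `&`
      [set t | (z t i).2 <= (z t i).1]) `&`
   ([set t | 0 < (z t i).1] `&` [set t | (z t i).1 < 1]) `&`
   ([set t | forall j, j \in J -> (j != i) ->
      ([set t | (z t j).1 < (z t i).1] `|` [set t | (z t i).1 < (z t j).1]) t] `&`
   [set t | forall kl : (I + bool) * (I + bool), valid i kl.1 -> valid i kl.2 ->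
      [set t | slopes_increase (pt t kl.1) (z t i) (pt t kl.2)] t])) t]).
  apply: measurable_forall => i; apply: measurable_imply => _.
  apply: measurableI; [apply: measurableI; [apply: measurableI;
    [apply: measurableI|]|apply: measurableI]|apply: measurableI].
  - exact: measurable_le.
  - apply: measurable_le => //; apply: measurable_funB => //.
    exact: measurable_funM.
  - exact: measurable_le.
  - exact: measurable_lt.
  - exact: measurable_lt.
  - apply: measurable_forall => j; do 2!apply: measurable_imply => _.
    by apply: measurableU; exact: measurable_lt.
  - apply: measurable_forall => kl; do 2!apply: measurable_imply => _.
    exact: measurable_slopes.
apply/seteqP; split=> t /=.
  move=> /cupP H i iJ; have [[h1 h2 h3] /andP[h4 h5] h6 h7] := H i iJ.
  split; first by split; [split; [split|]|split].
  split=> [j jJ ji|[k l] /= vk vl].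
    by have := h6 j jJ ji; rewrite neq_lt => /orP.
  have oth (k' : I + bool) : valid i k' ->
      [\/ pt t k' = (0, 0), pt t k' = (1, 1) |
      exists j, [/\ j \in J, j != i & pt t k' = z t j]].
    case: k' => [j /= /andP[jJ ji]|[] _ /=]; last by apply: Or31.
    - by apply: Or33; exists j.
    - by apply: Or32.
  by apply: h7; exact: oth.
move=> H; apply/cupP => i iJ.
have [[[[h1 h2] h3] [h4 h5]] [h6 h7]] := H i iJ.
split=> //; first by rewrite h4 h5.
  by move=> j jJ ji; rewrite neq_lt; apply/orP; exact: h6.
have oth (a : R * R) : [\/ a = (0, 0), a = (1, 1) |
      exists j, [/\ j \in J, j != i & a = z t j]] ->
    exists2 k, valid i k & a = pt t k.
  move=> [->|->|[j [jJ ji ->]]]; [by exists (inr false)|by exists (inr true)|].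
  by exists (inl j) => //=; rewrite jJ ji.
move=> a b /oth[k vk ->] /oth[l vl ->].
exact: (h7 (k, l)).
Qed.

Lemma sum_ltn (n m : nat) : (\sum_(j < n) (j < m) = minn n m)%N.
Proof. by elim: n => [|n IH]; rewrite ?big_ord0 ?big_ord_recr /= ?IH; lia. Qed.

Lemma measurable_longest_cup (I : finType) (z : T -> I -> R * R) :
  (forall i, measurable_fun setT (fun t => z t i)) ->
  measurable_fun setT (fun t => (longest_cup (z t))%:R : R).
Proof.
move=> mz; pose B j := [set t | (j < longest_cup (z t))%N].
have mB j : measurable (B j).
  rewrite (_ : B j = [set t | exists J : {set I},
      (if (j < #|J|)%N then [set t | cup (z t) J] else set0) t]).
    by apply: measurable_exists => J; case: ifP => // _; exact: measurable_cup.
  apply/seteqP; split=> t; rewrite /B /=.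
    by have [J cJ <-] := longest_cupP (z t) => jJ; exists J; rewrite jJ.
  move=> [J]; case: ifP => // jJ /longest_cup_ge; exact: leq_trans.
rewrite (_ : (fun t => _) = (fun t => \sum_(j < #|I|) (\1_(B j) t : R))).
  by apply: measurable_sum => j; exact: measurable_indic.
apply/funext => t; under eq_bigr do rewrite indicE.
rewrite -natr_sum; congr (_%:R).
rewrite -[LHS](minn_idPr (longest_cup_leq_card (z t))) -sum_ltn.
by apply: eq_bigr => j _; congr nat_of_bool; apply/idP/idP; rewrite inE.
Qed.

End measurability.

(** * Independent uniform points of the standard triangle *)

Lemma measurable_std_triangle (R : realType) : measurable (@std_triangle R).
Proof.
rewrite (_ : @std_triangle R = [set q | 0 <= q.2] `&`
  [set q | 2 * q.1 - 1 <= q.2] `&` [set q | q.2 <= q.1]).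
  have mc (r : R) : measurable_fun setT (fun _ : R * R => r).
    exact: measurable_cst.
  apply: measurableI; [apply: measurableI|]; apply: measurable_le => //.
  by apply: measurable_funB => //; exact: measurable_funM.
by apply/seteqP; split=> q [] => [h1 h2 h3|[]].
Qed.

Lemma area_box (R : realType) (a b c d : R) : a <= b -> c <= d ->
  area (`[a, b] `*` `[c, d]) = ((b - a) * (d - c))%:E.
Proof.
move=> ab cd; have itvE (x y : R) : x <= y ->
    lebesgue_measure (`[x, y]%classic : set R) = (y - x)%:E.
  rewrite le_eqVlt => /orP[/eqP ->|xy]; rewrite lebesgue_measure_itv /= lte_fin.
    by rewrite ltxx subrr.
  by rewrite xy.
by rewrite /area product_measure1E//= !itvE.
Qed.

Lemma le_area (R : realType) (A B : set (R * R)) : measurable A ->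
  measurable B -> A `<=` B -> (area A <= area B)%E.
Proof. by move=> mA mB AB; apply: le_measure; rewrite ?inE. Qed.

(** The box shows that the standard triangle has positive area, and that a
single point forms a chain with positive probability. *)
Definition low_box (R : realType) : set (R * R) :=
  `[8^-1 * 3, 2^-1] `*` `[16^-1, 4^-1].

Lemma low_box_sub (R : realType) : @low_box R `<=` @std_triangle R.
Proof.
move=> [x y] /=; rewrite /low_box /= !in_itv /= => -[/andP[h1 h2] /andP[h3 h4]].
by rewrite /std_triangle /=; split; lra.
Qed.

Lemma measurable_low_box (R : realType) : measurable (@low_box R).
Proof. by apply: measurableX. Qed.

Lemma area_low_box (R : realType) : (0 < area (@low_box R))%E.
Proof.
by rewrite area_box; [rewrite lte_fin; apply: mulr_gt0; lra|lra|lra].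
Qed.

Lemma area_std_triangle (R : realType) :
  exists2 a : R, 0 < a & area (@std_triangle R) = a%:E.
Proof.
have mT := @measurable_std_triangle R.
have h1 : (area (@std_triangle R) <= 1%:E)%E.
  have -> : 1%:E = area (`[0 : R, 1] `*` `[0 : R, 1]).
    by rewrite area_box// subr0 mulr1.
  apply: le_area => //; first exact: measurableX.
  move=> [x y] [/= h1 h2 h3] /=; rewrite !in_itv /=.
  by split; apply/andP; split; lra.
have h0 : (0 < area (@std_triangle R))%E.
  apply: (lt_le_trans (area_low_box R)).
  by apply: le_area => //; [exact: measurable_low_box|exact: low_box_sub].
move: h1 h0; case: (area _) => [a|//|//] _; rewrite lte_fin => a0.
by exists a.
Qed.

Definition std_uniform (R : realType) (A : set (R * R)) : \bar R :=
  (area (A `&` @std_triangle R) / area (@std_triangle R))%E.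

Lemma std_uniform1 (R : realType) : std_uniform (@std_triangle R) = 1%E.
Proof.
have [a a0 E] := area_std_triangle R.
by rewrite /std_uniform setIid E divee ?gt_eqF//= lte_fin.
Qed.

Section sample.
Context (R : realType) d (O : measurableType d) (P : probability O R) (n : nat).
Implicit Type Z : 'I_n -> O -> R * R.

(** Subfamilies are covered by taking some of the sets to be the whole
plane. *)
Definition independent Z : Prop :=
  forall A : 'I_n -> set (R * R), (forall i, measurable (A i)) ->
    P [set w | forall i, A i (Z i w)] = (\prod_i P (Z i @^-1` A i))%E.

Definition std_sample Z : Prop :=
  [/\ forall i, measurable_fun setT (Z i), independent Z &
    forall i A, measurable A -> P (Z i @^-1` A) = std_uniform A].

(** Seen through the zoom to one triangle along the parabola, a sample becomes
one of these, with [q] the share of that triangle in the area. *)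
Definition thin_sample (q : R) Z : Prop :=
  [/\ forall i, measurable_fun setT (Z i), independent Z &
    forall i A, measurable A -> A `<=` @std_triangle R ->
      P (Z i @^-1` A) = (q%:E * std_uniform A)%E].

Definition expected_cup Z : \bar R :=
  (\int[P]_w (longest_cup (Z ^~ w))%:R%:E)%E.

Lemma measurable_sample_cup Z : (forall i, measurable_fun setT (Z i)) ->
  measurable_fun setT (fun w => (longest_cup (Z ^~ w))%:R%:E : \bar R).
Proof.
move=> mZ; apply/measurable_EFinP.
exact: (@measurable_longest_cup R d O 'I_n (fun w i => Z i w)).
Qed.

End sample.

Lemma integral_mrestr (R : realType) d (O : measurableType d)
    (mu : {measure set O -> \bar R}) (A : set O) (mA : measurable A)
    (h : O -> \bar R) :
  measurable_fun setT h -> (forall w, 0 <= h w)%E ->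
  (\int[mrestr mu mA]_w h w = \int[mu]_(w in A) h w)%E.
Proof.
move=> mh h0; rewrite -(setUv A) ge0_integral_setU//.
- rewrite (@null_set_integral _ _ _ _ (~` A)).
  + rewrite adde0; apply: eq_measure_integral => B mB BA.
    by rewrite -[LHS]/(mu (B `&` A)) setIidl.
  + exact: measurableC.
  + exact: measurable_funS mh.
  + by rewrite -[LHS]/(mu (~` A `&` A)) setICl measure0.
- exact: measurableC.
- by rewrite setUv.
- by apply/disj_setPCl.
Qed.

Section conditioning.
Context (R : realType) d (O : measurableType d) (P : probability O R) (n : nat).
Context d' (O' : measurableType d') (P' : probability O' R) (m : nat).
Variables (q : R) (W : 'I_n -> O -> R * R) (Z : 'I_m -> O' -> R * R).
Hypotheses (q01 : 0 <= q <= 1) (sW : thin_sample P q W) (sZ : std_sample P' Z).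

Definition pattern (J : {set 'I_n}) : set O :=
  [set w | forall i, (i \in J) = `[< std_triangle (W i w) >]].

Let side (J : {set 'I_n}) i : set (R * R) :=
  if i \in J then @std_triangle R else ~` @std_triangle R.

Let patternE J : pattern J = [set w | forall i, side J i (W i w)].
Proof.
apply/seteqP; split=> w H i; have := H i; rewrite /side.
  by case: ifP => _ /esym; [move=> /asboolP|move=> /asboolPn].
by case: ifP => _ => [/asboolP ->|/asboolPn/negbTE ->].
Qed.

Let mside J i : measurable (side J i).
Proof.
rewrite /side; case: ifP => _; first exact: measurable_std_triangle.
by apply: measurableC; exact: measurable_std_triangle.
Qed.

Let measurable_preimW i A : measurable A -> measurable (W i @^-1` A).
Proof.
by case: sW => mW _ _ mA; rewrite -[X in measurable X]setTI; exact: mW.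
Qed.

Lemma measurable_pattern J : measurable (pattern J).
Proof.
by rewrite patternE; apply: (measurable_forall (A := fun i => W i @^-1` side J i))
  => i; exact: measurable_preimW.
Qed.

Let PWT i : P (W i @^-1` @std_triangle R) = q%:E.
Proof.
case: sW => _ _ ->//; last exact: measurable_std_triangle.
by rewrite std_uniform1 mule1.
Qed.

Let PWnT i : P (W i @^-1` (~` @std_triangle R)) = (1 - q)%:E.
Proof.
rewrite -preimage_setC probability_setC ?PWT//.
by apply: measurable_preimW; exact: measurable_std_triangle.
Qed.

Let pat_weight (J : {set 'I_n}) : R := q ^+ #|J| * (1 - q) ^+ (n - #|J|).

Let pat_weight_ge0 J : 0 <= pat_weight J.
Proof.
by case/andP: q01 => q0 q1; rewrite /pat_weight mulr_ge0 ?exprn_ge0 ?subr_ge0.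
Qed.

Let pat_weightE (J : {set 'I_n}) : (pat_weight J)%:E =
  (\prod_(i < n) if i \in J then q%:E else (1 - q)%:E)%E.
Proof.
rewrite (bigID (mem J)) /= (eq_bigr (fun _ => q%:E)); last by move=> i ->.
rewrite [X in (_ * X)%E](eq_bigr (fun _ => (1 - q)%:E)); last first.
  by move=> i /negbTE ->.
rewrite !prodEFin -EFinM !prodr_const; congr (_ * _ ^+ _)%:E.
have E : (#|J| + #|[predC J]| = n)%N by rewrite cardC card_ord.
by rewrite -[RHS](addKn #|J|) E.
Qed.

(** Given which points fall in the triangle, these points are again independent
and uniform, so that any [m] of them are distributed as [Z]. *)
Lemma pattern_cup (J : {set 'I_n}) (f : 'I_m -> 'I_n) : injective f ->
  (forall l, f l \in J) ->
  (\int[P]_(w in pattern J) (longest_cup (fun l => W (f l) w))%:R%:E =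
    (q ^+ #|J| * (1 - q) ^+ (n - #|J|))%:E * expected_cup P' Z)%E.
Proof.
move=> fi fJ; have [mW iW W_u] := sW; have [mZ iZ Z_u] := sZ.
pose h (t : m.-tuple (R * R)) : \bar R := (longest_cup (tnth t))%:R%:E.
have mh : measurable_fun setT h.
  apply/measurable_EFinP; apply: measurable_longest_cup => i.
  exact: measurable_tnth.
have mP := measurable_pattern J.
pose c : {nonneg R} := NngNum (pat_weight_ge0 J).
pose X1 l := W (f l).
have hE (p : 'I_m -> R * R) : h [tuple p l | l < m] = (longest_cup p)%:R%:E.
  by rewrite /h; congr (longest_cup _)%:R%:E; apply/funext => l; rewrite tnth_mktuple.
have h0 t : (0 <= h t)%E by rewrite /h lee_fin.
transitivity (\int[mrestr P mP]_w h [tuple X1 i w | i < m])%E.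
  rewrite integral_mrestr//.
  + by apply: eq_integral => w _; rewrite hE.
  + apply/measurable_EFinP.
    have -> : (fun w => (longest_cup (tnth [tuple X1 i w | i < m]))%:R) =
        (fun w => (longest_cup (fun l => W (f l) w))%:R : R).
      apply/funext => w; congr (longest_cup _)%:R; apply/funext => l.
      by rewrite tnth_mktuple.
    exact: (@measurable_longest_cup R _ O 'I_m (fun w l => W (f l) w)).
rewrite (@integral_law R _ _ m _ O _ O' (mrestr P mP) P' c X1 Z
  (fun l => mW (f l)) mZ h _ mh h0).
  by congr (_ * _)%E; apply: eq_integral => w _; rewrite hE.
move=> A mA; rewrite [X in _ = (_ * X)%E](iZ A mA).
rewrite -[LHS]/(P ([set w | forall l, A l (X1 l w)] `&` pattern J)) patternE.
pose B i := side J i `&` [set x | forall l, f l = i -> A l x].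
have mB i : measurable (B i).
  apply: measurableI => //; apply: measurable_forall => l.
  by apply: measurable_imply => _.
have -> : [set w | forall l, A l (X1 l w)] `&`
    [set w | forall i, side J i (W i w)] = [set w | forall i, B i (W i w)].
  apply/seteqP; split=> [w [/= Aw sw] i|w Bw]; last first.
    by split=> i /=; [have [_] := Bw (f i); apply|have [] := Bw i].
  by split=> // l fl; rewrite -fl; exact: Aw.
rewrite iW// pat_weightE.
transitivity (\prod_(i < n) ((if i \in J then q%:E else (1 - q)%:E) *
    (if i \in [set f l | l : 'I_m]%SET then std_uniform (B i) else 1))%E)%E.
  apply: eq_bigr => i _; rewrite /B /side.
  have [iJ|iJ] := boolP (i \in J).
    rewrite W_u//; last by have := mB i; rewrite /B /side iJ.
    case: ifPn => // /imsetP iN; congr (_ * _)%E; rewrite -(std_uniform1 R).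
    congr std_uniform; rewrite (_ : mkset _ = setT) ?setIT//.
    by apply/seteqP; split=> // x _ l fl; case: iN; exists l.
  rewrite ifF; last by apply/negP => /imsetP[l _ il]; move: iJ; rewrite il fJ.
  rewrite mule1 -(PWnT i); congr (P (W i @^-1` _)).
  rewrite (_ : mkset _ = setT) ?setIT//.
  by apply/seteqP; split=> // x _ l fl; move: iJ; rewrite -fl fJ.
rewrite big_split /=; congr (_ * _)%E.
rewrite -big_mkcond /= big_imset /=; last by move=> l l' _ _ /fi.
apply: eq_bigr => l _.
  rewrite (Z_u l (A l) (mA l)) /std_uniform /B /side (fJ l).
congr (area _ / _)%E; apply/seteqP; split=> x /=.
  by move=> [[Tx /(_ _ erefl)]].
move=> [Ax Tx]; split=> //; split=> // l' /fi; by move=> ->.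
Qed.

(** The probability that a binomial variable with parameters [n] and [q] is at
least [k]. *)
Definition binomial_tail (k : nat) : R :=
  \sum_(J : {set 'I_n} | (k <= #|J|)%N) q ^+ #|J| * (1 - q) ^+ (n - #|J|).

(** The patterns are disjoint events. On each that leaves at least [m] points in
the triangle, the longest chain is no shorter than that of [m] of these
points. *)
Lemma thin_sample_cup :
  ((binomial_tail m)%:E * expected_cup P' Z <= expected_cup P W)%E.
Proof.
have [mW iW W_u] := sW.
have mlW k (f : 'I_k -> 'I_n) : measurable_fun setT
    (fun w => (longest_cup (fun l => W (f l) w))%:R%:E : \bar R).
  apply/measurable_EFinP.
  exact: (@measurable_longest_cup R _ O 'I_k (fun w l => W (f l) w)).
have [m0|m0] := posnP m.
  have -> : expected_cup P' Z = 0%E.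
    rewrite /expected_cup; apply: integral0_eq => w _.
    by have := longest_cup_leq_card (Z ^~ w);
      rewrite [X in (_ <= X)%N]card_ord [X in (_ <= X)%N]m0 leqn0 => /eqP ->.
  by rewrite mule0; apply: integral_ge0 => w _; rewrite lee_fin.
have [n0|n_gt0] := posnP n.
  rewrite /binomial_tail big_pred0 ?mul0e.
    by apply: integral_ge0 => w _; rewrite lee_fin.
  move=> J; apply/negbTE; rewrite -ltnNge; apply: leq_ltn_trans m0.
  by rewrite (leq_trans (max_card _))// card_ord n0.
have i0 : 'I_n by exact: Ordinal n_gt0.
have /choice[F FP] : forall J : {set 'I_n}, exists f : 'I_m -> 'I_n,
    (m <= #|J|)%N -> injective f /\ forall l, f l \in J.
  move=> J; have [mJ|mJ] := leqP m #|J|; last by exists (fun=> i0).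
  exists (fun l => enum_val (widen_ord mJ l)) => _; split=> [l l'|l].
    by move/enum_val_inj/(congr1 val) => /= ll; apply: val_inj.
  exact: enum_valP.
pose g J w : \bar R :=
  ((fun w => (longest_cup (fun l => W (F J l) w))%:R%:E) \_ (pattern J)) w.
have g0 J w : (0 <= g J w)%E.
  by rewrite /g patchE; case: ifP => // _; rewrite lee_fin.
have mg J : measurable_fun setT (g J).
  apply/(measurable_restrictT _ (measurable_pattern J)).
  exact: measurable_funS (mlW m (F J)).
have -> : ((binomial_tail m)%:E * expected_cup P' Z =
    \int[P]_w (\sum_(J <- enum [pred J : {set 'I_n} | (m <= #|J|)%N]) g J w))%E.
  rewrite ge0_integral_sum// big_enum /= /binomial_tail -sumEFin.
  rewrite ge0_sume_distrl; last first.
    by move=> J _; rewrite lee_fin; exact: pat_weight_ge0.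
  apply: eq_bigr => J mJ; have [Fi FJ] := FP J mJ.
  by rewrite -(pattern_cup Fi FJ) integral_mkcond.
apply: ge0_le_integral => //.
- by move=> w _; apply: sume_ge0.
- exact: emeasurable_sum.
move=> w _; pose J0 := [set i | `[< std_triangle (W i w) >]]%SET.
have pJ J : pattern J w -> J = J0.
  by move=> pJ; apply/setP => i; rewrite inE pJ.
rewrite big_enum /=; have [mJ0|mJ0] := boolP (m <= #|J0|)%N.
  rewrite (bigD1 J0) //= big1 ?adde0; last first.
    move=> J /andP[_ JJ0]; rewrite /g patchE ifF//; apply/negP.
    by rewrite inE => /pJ JE; rewrite JE eqxx in JJ0.
  rewrite /g patchE; case: ifP => _; last by rewrite lee_fin.
  rewrite lee_fin ler_nat; have [Fi _] := FP J0 mJ0.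
  exact: (longest_cup_comp (W ^~ w) Fi).
rewrite big1 ?lee_fin// => J mJ; rewrite /g patchE ifF//; apply/negP.
by rewrite inE => /pJ JE; move: mJ; rewrite inE JE (negbTE mJ0).
Qed.

End conditioning.

(** * Superadditivity in expectation *)

(** The [m]-th power bounds the probability that a binomial variable of mean
[(1 + e) m] falls below [m]. *)
Definition chernoff (R : realType) (e : R) : R := (1 + e) * expR (- e).

Lemma chernoff_lt1 (R : realType) (e : R) : 0 < e -> 0 < chernoff e < 1.
Proof.
move=> e0; rewrite /chernoff mulr_gt0 ?expR_gt0//=; last by lra.
by rewrite expRN ltr_pdivrMr ?expR_gt0// mul1r expR_gt1Dx ?gt_eqF.
Qed.

Lemma sum_pattern (R : realType) (n : nat) (x y : R) :
  \sum_(J : {set 'I_n}) x ^+ #|J| * y ^+ (n - #|J|) = (x + y) ^+ n.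
Proof.
rewrite -[n in RHS]card_ord -prodr_const bigA_distr.
apply: eq_bigr => J _; rewrite (bigID (mem J)) /=.
rewrite (eq_bigr (fun _ => x)); last by move=> i ->.
rewrite [X in _ = _ * X](eq_bigr (fun _ => y)); last first.
  by move=> i /negbTE ->.
rewrite !prodr_const; congr (_ * _ ^+ _).
have E : (#|J| + #|[predC J]| = n)%N by rewrite cardC card_ord.
by rewrite -[RHS](addKn #|J|) E.
Qed.

(** Chernoff's bound. With [t = 1 / (1 + e)], the factor [t ^ (#|J| - m)] does
not diminish the weight of a pattern [J] of fewer than [m] points, and turns the
sum of the weights of all patterns into a power of a binomial. *)
Lemma binomial_tail_ge (R : realType) (n m : nat) (q e : R) : 0 <= q <= 1 ->
  0 < e -> (1 + e) * m%:R <= n%:R * q ->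
  1 - chernoff e ^+ m <= binomial_tail n q m.
Proof.
move=> /andP[q0 q1] e0 mn.
have := sum_pattern n q (1 - q); rewrite [q + _]addrC subrK expr1n.
rewrite (bigID (fun J : {set 'I_n} => (m <= #|J|)%N)) /=.
rewrite -/(binomial_tail n q m) => <-; rewrite lerBlDr lerD2l.
have e1 : 0 < 1 + e by lra.
pose t := (1 + e)^-1.
have t0 : 0 < t by rewrite invr_gt0.
have t1 : t <= 1 by rewrite invf_le1//; lra.
have term (J : {set 'I_n}) : 0 <= q ^+ #|J| * (1 - q) ^+ (n - #|J|).
  by rewrite mulr_ge0// exprn_ge0//; lra.
apply: (@le_trans _ _ (\sum_(J : {set 'I_n})
    t^-1 ^+ m * ((q * t) ^+ #|J| * (1 - q) ^+ (n - #|J|)))).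
  have termE (J : {set 'I_n}) :
      t^-1 ^+ m * ((q * t) ^+ #|J| * (1 - q) ^+ (n - #|J|)) =
      t^-1 ^+ m * t ^+ #|J| * (q ^+ #|J| * (1 - q) ^+ (n - #|J|)).
    by rewrite exprMn; ring.
  have tm (J : {set 'I_n}) : 0 <= t^-1 ^+ m * t ^+ #|J|.
    by rewrite mulr_ge0 ?exprn_ge0 ?invr_ge0 ?ltW.
  rewrite [leRHS](bigID (fun J : {set 'I_n} => (m <= #|J|)%N)) /=.
  rewrite -[leLHS]add0r; apply: lerD.
    by apply: sumr_ge0 => J _; rewrite termE mulr_ge0.
  apply: ler_sum => J; rewrite -ltnNge => Jm; rewrite termE ler_peMl//.
  rewrite exprVn mulrC ler_pdivlMr ?exprn_gt0// mul1r.
  by apply: ler_wiXn2l => //; [exact: ltW|exact: ltnW].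
rewrite -mulr_sumr sum_pattern.
have tE : t^-1 = 1 + e by rewrite invrK.
have te : t * (1 + e) = 1 by rewrite mulVf ?gt_eqF.
have hexp : q * t + (1 - q) <= expR (- ((1 - t) * q)).
  by apply: le_trans (expR_ge1Dx _); lra.
rewrite /chernoff exprMn tE ler_pM2l ?exprn_gt0//.
apply: (@le_trans _ _ (expR (- ((1 - t) * q)) ^+ n)).
  by apply: lerXn2r => //; rewrite ?nnegrE ?expR_ge0//; nra.
rewrite -!expRM_natr ler_expR !mulNr lerN2.
have -> : (1 - t) * q * n%:R = (1 - t) * (n%:R * q) by ring.
apply: (@le_trans _ _ ((1 - t) * ((1 + e) * m%:R))).
  have -> : (1 - t) * ((1 + e) * m%:R) = (1 + e - t * (1 + e)) * m%:R by ring.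
  by rewrite te [1 + e]addrC addrK.
by apply: ler_wpM2l => //; lra.
Qed.

(** The area shrinks by [k ^ 3], and the triangle lies in the standard one. *)
Lemma zoom_sample (R : realType) d (O : measurableType d)
    (P : probability O R) (n k i : nat) (Z : 'I_n -> O -> R * R) :
  std_sample P Z -> (i < k)%N ->
  thin_sample P (k%:R ^+ 3)^-1 (fun j w => zoom k i (Z j w)).
Proof.
move=> [mZ iZ uZ] ik; have k0 : (0 < k)%N by exact: leq_ltn_trans ik.
have [mz sz] := scales_area_zoom R i k0.
have mpre A : measurable A -> measurable (@zoom R k i @^-1` A).
  by move=> mA; rewrite -[X in measurable X]setTI; exact: mz.
split=> [j|A mA|j A mA AT].
- exact: measurableT_comp.
- exact: (iZ (fun j => zoom k i @^-1` A j) (fun j => mpre _ (mA j))).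
rewrite -[X in P X]/(Z j @^-1` (zoom k i @^-1` A)) uZ; last exact: mpre.
rewrite /std_uniform setIidl; last by move=> q /= /AT; exact: zoom_std_triangle.
by rewrite sz// setIidl// muleA.
Qed.

Section superadditivity.
Context (R : realType) d (O : measurableType d) (P : probability O R) (n : nat).
Context d' (O' : measurableType d') (P' : probability O' R) (m : nat).
Variables (Z : 'I_n -> O -> R * R) (Z' : 'I_m -> O' -> R * R).
Hypotheses (sZ : std_sample P Z) (sZ' : std_sample P' Z').

(** Each of the [k] triangles along the parabola receives at least [m] points
except with probability at most [chernoff e ^ m]. *)
Lemma expected_cup_superadditive (k : nat) (e : R) : (0 < k)%N -> 0 < e ->
  (1 + e) * m%:R * k%:R ^+ 3 <= n%:R ->
  ((k%:R * (1 - chernoff e ^+ m))%:E * expected_cup P' Z' <=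
    expected_cup P Z)%E.
Proof.
move=> k0 e0 kn; have kR : 0 < k%:R :> R by rewrite ltr0n.
have k3 : 1 <= k%:R ^+ 3 :> R by rewrite exprn_ege1// ler1n.
have q01 : 0 <= ((k%:R : R) ^+ 3)^-1 <= 1.
  apply/andP; split; first by rewrite invr_ge0 exprn_ge0// ltW.
  by rewrite invf_le1// exprn_gt0.
have E0 : (0 <= expected_cup P' Z')%E.
  by apply: integral_ge0 => w _; rewrite lee_fin.
have mcup i : measurable_fun setT
    (fun w => (longest_cup (fun j => zoom k i (Z j w)))%:R%:E : \bar R).
  case: sZ => mZ _ _.
  apply: (@measurable_sample_cup R d O n (fun j w => zoom k i (Z j w))) => j.
  by apply: measurableT_comp => //; have [] := scales_area_zoom R i k0.
apply: (@le_trans _ _ (\sum_(i < k)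
    expected_cup P (fun j w => zoom k i (Z j w)))%E); last first.
  rewrite /expected_cup -ge0_integral_sum//.
  apply: ge0_le_integral => //.
  - by move=> w _; apply: sume_ge0 => i _; rewrite lee_fin.
  - exact: emeasurable_sum.
  - by case: sZ => mZ _ _; exact: measurable_sample_cup.
  - move=> w _; rewrite sumEFin lee_fin -natr_sum ler_nat.
    exact: (longest_cup_superadditive (Z ^~ w) k).
apply: (@le_trans _ _ (\sum_(i < k)
    (1 - chernoff e ^+ m)%:E * expected_cup P' Z')%E).
  have /andP[c0 c1] := chernoff_lt1 e0.
  rewrite -ge0_sume_distrl; last first.
    by move=> i _; rewrite lee_fin subr_ge0 exprn_ile1 ?ltW.
  rewrite sumEFin sumr_const card_ord -[X in (_ <= X%:E * _)%E]mulr_natl.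
  exact: lexx.
apply: lee_sum => i _.
apply: le_trans (thin_sample_cup q01 (zoom_sample sZ (ltn_ord i)) sZ').
apply: lee_wpmul2r => //; rewrite lee_fin; apply: binomial_tail_ge => //.
by rewrite ler_pdivlMr// exprn_gt0.
Qed.

End superadditivity.

(** * Few narrow regions contain all chains *)

(** The maximum of the supporting lines and of the first axis. The slopes lie
between those of the sides of the triangle, 0 and 2. *)
Lemma cup_envelope (R : realType) (I : finType) (z : I -> R * R) (J : {set I}) :
  cup z J -> exists f : R -> R,
  [/\ forall x y t, 0 <= t <= 1 ->
        f (t * x + (1 - t) * y) <= t * f x + (1 - t) * f y,
      forall x y, x <= y -> f x <= f y <= f x + 2 * (y - x),
      f 0 = 0 & forall i, i \in J -> f (z i).1 = (z i).2].
Proof.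
move=> cJ; have /choice[s sP] : forall i, exists s : R, i \in J ->
    [/\ 0 <= s <= 2, (z i).2 - s * (z i).1 < 0 &
    forall j, j \in J -> j != i -> (z i).2 + s * ((z j).1 - (z i).1) < (z j).2].
  move=> i; have [iJ|] := boolP (i \in J); last by exists 0.
  have [[h1 h2 h3] [s [s0 s1 sJ]]] := cJ _ iJ.
  have /andP[x0 x1] := cup_x01 cJ iJ.
  exists s => _; split=> //; apply/andP; split; nra.
pose l i x := (z i).2 + s i * (x - (z i).1).
pose f x := \big[Num.max/0]_(i in J) l i x.
have f_ge0 x : 0 <= f x by exact: bigmax_ge_id.
have lf i x : i \in J -> l i x <= f x by move=> iJ; exact: le_bigmax_cond.
have f_le x a : 0 <= a -> (forall i, i \in J -> l i x <= a) -> f x <= a.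
  by move=> a0 la; exact: bigmax_le.
exists f; split.
- move=> x y t /andP[t0 t1]; have [fx fy] := (f_ge0 x, f_ge0 y).
  apply: f_le => [|i iJ]; first by nra.
  have := lf i x iJ; have := lf i y iJ.
  have -> : l i (t * x + (1 - t) * y) = t * l i x + (1 - t) * l i y.
    by rewrite /l; ring.
  by nra.
- move=> x y xy; have fx := f_ge0 x; have fy := f_ge0 y.
  apply/andP; split.
    apply: f_le => // i iJ; apply: le_trans (lf i y iJ).
    by have [/andP[s0 s2] _ _] := sP i iJ; rewrite /l; nra.
  apply: f_le => [|i iJ]; first by lra.
  by have := lf i x iJ; have [/andP[s0 s2] _ _] := sP i iJ; rewrite /l; nra.
- apply: le_anti; rewrite f_ge0 andbT; apply: f_le => // i iJ.
  by have [_ h _] := sP i iJ; rewrite /l; lra.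
- move=> j jJ; have [[h1 h2 h3] _] := cJ _ jJ.
  apply: le_anti; apply/andP; split; last first.
    by have := lf j (z j).1 jJ; rewrite /l subrr mulr0 addr0.
  apply: f_le => // i iJ; have [<-|ji] := eqVneq j i.
    by rewrite /l subrr mulr0 addr0.
  by have [_ _ /(_ j jJ ji)/ltW] := sP i iJ.
Qed.

Definition strip (R : realType) (a b s c d : R) : set (R * R) :=
  (fun q : R * R => (q.1, q.2 + s * q.1)) @^-1` (`[a, b] `*` `[c, d]).

Lemma measurable_strip (R : realType) (a b s c d : R) :
  measurable (strip a b s c d).
Proof.
rewrite -[X in measurable X]setTI.
by have [ms _] := scales_area_shear s; apply: ms => //; exact: measurableX.
Qed.

Lemma area_strip (R : realType) (a b s c d : R) : a <= b -> c <= d ->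
  area (strip a b s c d) = ((b - a) * (d - c))%:E.
Proof.
move=> ab cd; have [_ ->] := scales_area_shear s; last exact: measurableX.
by rewrite mul1e area_box.
Qed.

(** A strictly increasing code [c] records the increments
[e i = c i - 2 * i] of the heights of a convex curve over the points [i / m],
in units of [1 / m ^ 2] and rounded down. Over [[i / m, (i + 1) / m]] the
curve lies between the chord and the continuation of the previous chord, up to
the rounding; [code_prev] starts with 0, a lower bound for the first slope. *)
Section code_region.
Context (R : realType) (m : nat) (c : nat -> nat).

Definition code_step i : R := (c i)%:R - 2 * i%:R.
Definition code_height i : R := \sum_(l < i) code_step l.
Definition code_prev i : R := if i is l.+1 then code_step l else 0.
Definition code_strip i : set (R * R) :=
  strip (i%:R / m%:R) ((i%:R + 1) / m%:R) (- (code_step i / m%:R))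
    ((code_height i - (code_step i - code_prev i + 1) - code_step i * i%:R)
       / m%:R ^+ 2)
    ((code_height i + 2 - code_step i * i%:R) / m%:R ^+ 2).
Definition code_region : set (R * R) := \big[setU/set0]_(i < m) code_strip i.

Lemma measurable_code_region : measurable code_region.
Proof. by apply: bigsetU_measurable => i _; exact: measurable_strip. Qed.

Lemma code_stripE i (x y : R) : (0 < m)%N ->
  i%:R <= m%:R * x <= i%:R + 1 ->
  code_height i - (code_step i - code_prev i + 1) <=
    m%:R ^+ 2 * y - code_step i * (m%:R * x - i%:R) <= code_height i + 2 ->
  code_strip i (x, y).
Proof.
move=> m0; have mR : 0 < m%:R :> R by rewrite ltr0n.
have m2 : 0 < m%:R ^+ 2 :> R by rewrite exprn_gt0.
move=> /andP[h1 h2] /andP[h3 h4]; rewrite /code_strip /strip /= !in_itv /=.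
split; apply/andP; split.
- by rewrite ler_pdivrMr// mulrC.
- by rewrite ler_pdivlMr// mulrC.
- rewrite ler_pdivrMr//.
  have -> : (y + - (code_step i / m%:R) * x) * m%:R ^+ 2 =
      m%:R ^+ 2 * y - code_step i * (m%:R * x).
    by field; rewrite gt_eqF.
  by lra.
- rewrite ler_pdivlMr//.
  have -> : (y + - (code_step i / m%:R) * x) * m%:R ^+ 2 =
      m%:R ^+ 2 * y - code_step i * (m%:R * x).
    by field; rewrite gt_eqF.
  by lra.
Qed.

(** The height of a strip is, up to a constant, a second difference of the
heights, so that the sum of the heights of the strips telescopes to the last
slope and [3 * m]. *)
Lemma area_code_region : (0 < m)%N ->
  (forall i, (i.+1 < m)%N -> (c i < c i.+1)%N) ->
  (forall i, (i < m)%N -> (c i < 4 * m)%N) ->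
  (area code_region <= (6 / m%:R ^+ 2)%:E)%E.
Proof.
move=> m0 cS cm; have mR : 0 < m%:R :> R by rewrite ltr0n.
have m2 : 0 < m%:R ^+ 2 :> R by rewrite exprn_gt0.
have step i : (i < m)%N -> -1 <= code_step i - code_prev i.
  case: i => [|i] im; rewrite /code_prev /code_step.
    by rewrite mulr0 !subr0 (le_trans _ (ler0n _ _))// lerN10.
  have : (c i)%:R + 1 <= (c i.+1)%:R :> R by rewrite natr1 ler_nat cS.
  by rewrite -[i.+1%:R]natr1; lra.
have -> : (6 / m%:R ^+ 2)%:E = (\sum_(i < m) (6 / m%:R ^+ 3)%:E)%E :> \bar R.
  rewrite sumEFin sumr_const card_ord -mulr_natr; congr EFin; field.
  by rewrite gt_eqF.
apply: (@le_trans _ _ (\sum_(i < m) area (code_strip i))%E).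
  have := @Boole_inequality _ R (measurableTypeR R * measurableTypeR R)%type
    (lebesgue_measure \x lebesgue_measure)%E code_strip m.
  by apply => i _; exact: measurable_strip.
have areaE i : (i < m)%N -> area (code_strip i) =
    ((code_step i - code_prev i + 3) / m%:R ^+ 3)%:E.
  move=> im; rewrite area_strip; last 2 first.
  - by rewrite ler_pM2r ?invr_gt0//; lra.
  - by rewrite ler_pM2r ?invr_gt0//; have := step i im; lra.
  by congr EFin; field; rewrite gt_eqF.
rewrite (eq_bigr (fun i : 'I_m =>
    ((code_step i - code_prev i + 3) / m%:R ^+ 3)%:E)); last first.
  by move=> i _; rewrite areaE.
rewrite !sumEFin lee_fin -!mulr_suml ler_pM2r ?invr_gt0 ?exprn_gt0//.
rewrite big_split /= sumr_const card_ord -mulr_natr.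
have tele k : \sum_(i < k.+1) (code_step i - code_prev i) = code_step k.
  elim: k => [|k IH]; first by rewrite big_ord1 /= subr0.
  by rewrite big_ord_recr IH /= addrC subrK.
have := cm m.-1; case: (m) m0 mR => // k _ mR /(_ (ltnSn _)) /= ck.
rewrite tele /code_step sumr_const card_ord -mulr_natr.
have : (c k)%:R + 1 <= 4 * k.+1%:R :> R.
  by rewrite natr1 -natrM ler_nat.
by rewrite -[k.+1%:R]natr1; have : 0 <= k%:R :> R by []; lra.
Qed.

End code_region.

(** Convexity makes the second differences of the heights nonnegative before
rounding, hence at least [-1] after it, so that the term [2 * i] makes the code
increase strictly. As the slopes are at most 2, so are the steps at most
[2 * m]. *)
Lemma cup_code (R : realType) (I : finType) (z : I -> R * R) (J : {set I})
    (m : nat) : (0 < m)%N -> cup z J -> exists c : nat -> nat,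
  [/\ forall i, (i.+1 < m)%N -> (c i < c i.+1)%N,
      forall i, (i < m)%N -> (c i < 4 * m)%N &
      forall j, j \in J -> code_region m c (z j)].
Proof.
move=> m0 cJ; have mR : 0 < m%:R :> R by rewrite ltr0n.
have m2 : 0 < m%:R ^+ 2 :> R by rewrite exprn_gt0.
have [f [f_conv f_mono f0 fJ]] := cup_envelope cJ.
pose F i := m%:R ^+ 2 * f (i%:R / m%:R).
pose g i := Num.truncn (F i).
have f_ge0 x : 0 <= x -> 0 <= f x by move=> /f_mono /andP[]; rewrite f0.
have F_ge0 i : 0 <= F i.
  by rewrite mulr_ge0 ?(ltW m2)// f_ge0// divr_ge0// ltW.
have gP i : (g i)%:R <= F i < (g i)%:R + 1.
  by rewrite natr1; exact: truncn_itv.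
have F_mono i : F i <= F i.+1 <= F i + 2 * m%:R.
  have ii : i%:R / m%:R <= i.+1%:R / m%:R :> R.
    by rewrite ler_pM2r ?invr_gt0// ler_nat.
  have /andP[h1 h2] := f_mono _ _ ii.
  apply/andP; split; first by rewrite ler_pM2l.
  have -> : F i + 2 * m%:R =
      m%:R ^+ 2 * (f (i%:R / m%:R) + 2 * (i.+1%:R / m%:R - i%:R / m%:R)).
    by rewrite /F -natr1; field; rewrite gt_eqF.
  by rewrite ler_pM2l.
have F_conv i : F i.+1 - F i <= F i.+2 - F i.+1.
  have := f_conv (i%:R / m%:R) (i.+2%:R / m%:R) 2^-1.
  have -> : 2^-1 * (i%:R / m%:R) + (1 - 2^-1) * (i.+2%:R / m%:R) =
      i.+1%:R / m%:R :> R.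
    by rewrite -[i.+2%:R]natr1 -natr1; field; rewrite gt_eqF.
  have -> : 0 <= (2^-1 : R) <= 1 by apply/andP; split; lra.
  by move=> /(_ isT); rewrite /F => h; nra.
have gS i : (g i <= g i.+1)%N.
  rewrite -ltnS -(ltr_nat R) -natr1.
  have /andP[a1 _] := gP i; have /andP[_ b2] := gP i.+1.
  by have /andP[] := F_mono i; lra.
have gconv i : (2 * g i.+1 < g i.+2 + g i + 2)%N.
  have /andP[a1 a2] := gP i; have /andP[b1 b2] := gP i.+1.
  have /andP[c1 c2] := gP i.+2; have h := F_conv i.
  by rewrite -(ltr_nat R) natrM !natrD; lra.
pose c i := (g i.+1 - g i + 2 * i)%N.
have stepE i : code_step R c i = (g i.+1)%:R - (g i)%:R.
  rewrite /code_step /c natrD natrM natrB//; lra.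
have g0 : g 0%N = 0%N by rewrite /g /F mul0r f0 mulr0 truncn0.
have heightE i : code_height R c i = (g i)%:R.
  elim: i => [|i IH]; first by rewrite /code_height big_ord0 g0.
  by rewrite /code_height big_ord_recr -/(code_height R c i) IH /= stepE; lra.
exists c; split.
- by move=> i _; have := gS i; have := gS i.+1; have := gconv i; rewrite /c; lia.
- move=> i im; rewrite /c.
  have /andP[a1 a2] := gP i; have /andP[b1 b2] := gP i.+1.
  have /andP[_ h] := F_mono i.
  have : (g i.+1)%:R < (g i)%:R + 2%:R * m%:R + 1 + 1 :> R by lra.
  by rewrite -natrM -natrD !natr1 ltr_nat; have := gS i; lia.
move=> j jJ; have /andP[x0 x1] := cup_x01 cJ jJ.
have zf := fJ j jJ; move: x0 x1 zf; case: (z j) => x y /= x0 x1 zf.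
pose i := Num.truncn (m%:R * x).
have /andP[i1 i2] : i%:R <= m%:R * x < i%:R + 1.
  by rewrite natr1; apply: truncn_itv; rewrite mulr_ge0 ?ltW.
have im : (i < m)%N.
  by rewrite -(ltr_nat R) (le_lt_trans i1)// -[ltRHS]mulr1 ltr_pM2l.
rewrite /code_region -bigcup_mkord; exists i => //=.
apply: code_stripE => //; first by rewrite i1 ltW.
rewrite heightE stepE; set t := m%:R * x - i%:R.
have t0 : 0 <= t by rewrite /t; lra.
have t1 : t <= 1 by rewrite /t; lra.
have xE : x = (i%:R + t) / m%:R by rewrite /t; field; rewrite gt_eqF.
have /andP[a1 a2] := gP i; have /andP[b1 b2] := gP i.+1.
have up : m%:R ^+ 2 * y <= t * F i.+1 + (1 - t) * F i.
  have := f_conv (i.+1%:R / m%:R) (i%:R / m%:R) t; rewrite t0 t1 => /(_ isT).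
  have -> : t * (i.+1%:R / m%:R) + (1 - t) * (i%:R / m%:R) = x.
    by rewrite xE -natr1; field; rewrite gt_eqF.
  rewrite zf -(ler_pM2l m2) => /le_trans; apply.
  by rewrite /F; lra.
apply/andP; split; last by nra.
have low : i%N = 0%N /\ 0 <= m%:R ^+ 2 * y \/
    exists2 l, i = l.+1 & F i + t * (F i - F l) <= m%:R ^+ 2 * y.
  case: (posnP i) => [->|].
    by left; split=> //; rewrite mulr_ge0 ?(ltW m2)// -zf f_ge0// ltW.
  case E : i => [//|l] _; right; exists l => //; rewrite -E.
  have lE : l%:R = i%:R - 1 :> R by rewrite E -natr1 addrK.
  have t10 : 0 < 1 + t by lra.
  have := f_conv x (l%:R / m%:R) (1 + t)^-1.
  rewrite invr_ge0 ltW// invf_le1// lerDl t0 => /(_ isT).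
  have -> : (1 + t)^-1 * x + (1 - (1 + t)^-1) * (l%:R / m%:R) = i%:R / m%:R.
    rewrite xE lE; field; rewrite !gt_eqF//.
  rewrite zf => h; have : (1 + t) * F i <= m%:R ^+ 2 * y + t * F l.
    rewrite /F; have -> : m%:R ^+ 2 * y + t * (m%:R ^+ 2 * f (l%:R / m%:R)) =
      (1 + t) * (m%:R ^+ 2 * ((1 + t)^-1 * y +
        (1 - (1 + t)^-1) * f (l%:R / m%:R))) by field; rewrite gt_eqF.
    by rewrite ler_pM2l// ler_pM2l.
  by lra.
case: low => [[i0 y0]|[l il low]].
  have : (g i)%:R <= (g i.+1)%:R :> R by rewrite ler_nat.
  by rewrite /code_prev {1}i0 i0 g0 /=; nra.
rewrite il /code_prev stepE -il.
have /andP[d1 d2] := gP l.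
have : (2 * g i)%:R + 1 <= (g i.+1 + g l + 2)%:R :> R.
  by rewrite natr1 ler_nat il; exact: gconv.
rewrite (natrM _ 2 (g i)) !natrD => gc.
by nra.
Qed.

(** * An upper bound of the right order *)

Lemma ffact_leq_exp (n j : nat) : (n ^_ j <= n ^ j)%N.
Proof.
elim: j n => [|j IH] n //; rewrite ffactnS expnS leq_mul2l; apply/orP; right.
apply: leq_trans (IH _) _; case: j {IH} => // j.
by rewrite leq_exp2r ?leq_pred.
Qed.

Lemma exp_leq_ffact (n j : nat) : (n ^ j <= (n + j) ^_ j)%N.
Proof.
elim: j => [|j IH] //; rewrite ffactnSr expnSr leq_mul//; last by lia.
apply: leq_trans IH _; rewrite addnS.
elim: j (n + j)%N => [|j IH] k //.
by rewrite !ffactnSr leq_mul//; lia.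
Qed.

Lemma bin_leq_exp2 (n j : nat) : ('C(n, j) <= 2 ^ n)%N.
Proof.
have := card_draws 'I_n j; rewrite card_ord => <-.
by apply: leq_trans (max_card _) _; 
  rewrite -cardsT -powersetT card_powerset cardsT card_ord.
Qed.

Lemma exp_leq_fact (j : nat) : (j ^ j <= 4 ^ j * j`!)%N.
Proof.
apply: leq_trans (exp_leq_ffact j j) _; rewrite -bin_ffact leq_mul2r.
by rewrite (leq_trans (bin_leq_exp2 _ _)) ?orbT// addnn -mul2n expnM.
Qed.

(** Since [j ^ j <= 4 ^ j * j`!]. *)
Lemma bin_exp_le (R : realType) (n j : nat) (x : R) : (0 < j)%N -> 0 <= x ->
  'C(n, j)%:R * x ^+ j <= (4 * n%:R * x / j%:R) ^+ j.
Proof.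
move=> j0 x0; have jR : 0 < j%:R :> R by rewrite ltr0n.
have -> : 4 * n%:R * x / j%:R = 4 * n%:R * (x / j%:R) by rewrite mulrA.
rewrite exprMn -{1}(@divfK _ j%:R _ x) ?gt_eqF// [(x / _ * _) ^+ j]exprMn.
rewrite mulrCA mulrC; apply: ler_wpM2r.
  by rewrite exprn_ge0// divr_ge0// ltW.
rewrite -natrM -!natrX -natrM ler_nat expnMn.
apply: (@leq_trans ('C(n, j) * (4 ^ j * j`!))).
  by rewrite leq_mul2l exp_leq_fact orbT.
by rewrite mulnCA leq_mul2l bin_ffact ffact_leq_exp orbT.
Qed.

(** There are at most [2 ^ (4 * m)] codes, while [K * m] points lie in the
region of a given code with probability at most [2 ^- (8 * m)]. *)
Lemma tail_numeric (R : realType) (n m K : nat) (a : R) : 0 < a -> (0 < m)%N ->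
  (n <= m ^ 3)%N -> (8 <= K)%N -> 48 <= K%:R * a ->
  n%:R * ('C(4 * m, m) * 'C(n, K * m))%:R * (6 / m%:R ^+ 2 / a) ^+ (K * m) <= 1.
Proof.
move=> a0 m0 nm K8 Ka; have mR : 0 < m%:R :> R by rewrite ltr0n.
have KR : 0 < K%:R :> R by rewrite ltr0n; lia.
have x0 : 0 <= 6 / m%:R ^+ 2 / a.
  by rewrite !divr_ge0 ?exprn_ge0 ?ltW.
have Km0 : (0 < K * m)%N by lia.
rewrite natrM -!mulrA.
apply: (@le_trans _ _ (2 ^+ (3 * m) * (2 ^+ (4 * m) * 2^-1 ^+ (8 * m)))).
  apply: ler_pM => //; first by rewrite !mulr_ge0// exprn_ge0// !mulrA.
    rewrite -natrX ler_nat (leq_trans nm)// mulnC expnM leq_exp2r//.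
    exact/ltnW/ltn_expl.
  apply: ler_pM => //; first by rewrite !mulr_ge0// exprn_ge0// !mulrA.
    by rewrite -natrX ler_nat bin_leq_exp2.
  rewrite mulrA; apply: (le_trans (bin_exp_le _ Km0 x0)).
  apply: (@le_trans _ _ (2^-1 ^+ (K * m))); last first.
    by apply: ler_wiXn2l => //; [lra|rewrite leq_mul2r K8 orbT].
  apply: lerXn2r; rewrite ?nnegrE//.
    by rewrite divr_ge0// mulr_ge0// mulr_ge0.
  rewrite ler_pdivrMr ?ltr0n//.
  have nm' : n%:R <= m%:R ^+ 3 :> R by rewrite -natrX ler_nat.
  have -> : 4 * n%:R * (6 / m%:R ^+ 2 / a) = (24 * n%:R) / (m%:R ^+ 2 * a).
    by field; rewrite !gt_eqF.
  rewrite ler_pdivrMr; last by rewrite mulr_gt0// exprn_gt0.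
  have -> : 2^-1 * (K * m)%:R * (m%:R ^+ 2 * a) = 2^-1 * (K%:R * a) * m%:R ^+ 3.
    by rewrite natrM; ring.
  have m3 : 0 <= m%:R ^+ 3 :> R by rewrite exprn_ge0// ltW.
  by nra.
have -> : (8 * m = (3 * m + 4 * m) + m)%N by lia.
rewrite mulrA -exprD (exprD 2^-1 (3 * m + 4 * m)) mulrA -exprMn mulfV//.
by rewrite expr1n mul1r exprn_ile1//; lra.
Qed.

Lemma code_region_ext (R : realType) (m : nat) (c c' : nat -> nat) :
  (forall i, (i < m)%N -> c i = c' i) ->
  code_region m c = code_region m c' :> set (R * R).
Proof.
move=> cc; apply: eq_bigr => i _.
have s l : (l < m)%N -> code_step R c l = code_step R c' l.
  by move=> lm; rewrite /code_step cc.
rewrite /code_strip s// (_ : code_height R c i = code_height R c' i).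
  congr strip; congr ((_ - (_ - _ + 1) - _) / _).
  by have := ltn_ord i; case: (nat_of_ord i) => //= l /ltnW; exact: s.
by apply: eq_bigr => l _; rewrite s// (ltn_trans (ltn_ord l)).
Qed.

Lemma measure_bigU_le (R : realType) d (T : measurableType d)
    (mu : {measure set T -> \bar R}) (K : Type) (s : seq K) (A : K -> set T) :
  (forall k, measurable (A k)) ->
  (mu (\big[setU/set0]_(k <- s) A k) <= \sum_(k <- s) mu (A k))%E.
Proof.
move=> mA; elim: s => [|k s IH]; first by rewrite !big_nil measure0.
rewrite !big_cons; apply: (le_trans (measureU2 _ _ _)) => //.
  exact: bigsetU_measurable.
exact: leeD2l.
Qed.

Section upper_bound.
Context (R : realType) d (O : measurableType d) (P : probability O R) (n : nat).
Variables (Z : 'I_n -> O -> R * R) (a : R).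
Hypotheses (sZ : std_sample P Z) (a0 : 0 < a)
  (aE : area (@std_triangle R) = a%:E).

Lemma sample_inside (A : set (R * R)) (J : {set 'I_n}) (p : R) :
  measurable A -> (area A <= p%:E)%E ->
  (P [set w | forall i, i \in J -> A (Z i w)] <= ((p / a) ^+ #|J|)%:E)%E.
Proof.
case: sZ => mZ iZ uZ mA Ap.
have -> : [set w | forall i, i \in J -> A (Z i w)] =
    [set w | forall i, (if i \in J then A else setT) (Z i w)].
  apply/seteqP; split=> w /= H i; first by case: ifP => // /H.
  by move=> iJ; have := H i; rewrite iJ.
rewrite (iZ (fun i => if i \in J then A else setT)); last first.
  by move=> i; case: ifP.
rewrite (eq_bigr (fun i => if i \in J then std_uniform A else 1%E)); last first.
  move=> i _; case: ifP => _; first exact: uZ.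
  by rewrite preimage_setT probability_setT.
rewrite -big_mkcond /=.
have u0 : (0 <= std_uniform A)%E.
  by rewrite /std_uniform aE inver gt_eqF// mule_ge0// lee_fin invr_ge0 ltW.
have up : (std_uniform A <= (p / a)%:E)%E.
  rewrite /std_uniform aE inver gt_eqF// EFinM lee_wpmul2r ?lee_fin//.
    by rewrite invr_ge0 ltW.
  apply: le_trans Ap; apply: le_area => //.
  by apply: measurableI => //; exact: measurable_std_triangle.
move: u0 up; case: (std_uniform A) => [r|//|//]; rewrite !lee_fin => r0 rp.
by rewrite prodEFin prodr_const lee_fin lerXn2r// nnegrE (le_trans r0).
Qed.

(** A union bound over the codes and over the sets of [j] points that may lie
in the region of a code. *)
Lemma cup_tail (m j : nat) : (0 < m)%N ->
  (P [set w | (j <= longest_cup (Z ^~ w))%N] <=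
    (('C(4 * m, m) * 'C(n, j))%:R * (6 / m%:R ^+ 2 / a) ^+ j)%:E)%E.
Proof.
move=> m0; have [mZ _ _] := sZ.
pose C := [set t : m.-tuple 'I_(4 * m) | sorted ltn [seq val i | i <- t]]%SET.
pose D := [set J : {set 'I_n} | #|J| == j]%SET.
pose c (t : m.-tuple 'I_(4 * m)) i := nth 0%N [seq val i | i <- t] i.
pose A (k : (m.-tuple 'I_(4 * m)) * {set 'I_n}) : set O :=
  [set w | forall i, i \in k.2 -> code_region m (c k.1) (Z i w)].
have mA k : measurable (A k).
  apply: measurable_forall => i; apply: measurable_imply => _.
  by rewrite -[X in measurable X]setTI; apply: mZ => //; exact: measurable_code_region.
apply: (@le_trans _ _ (P (\big[setU/set0]_(k <- enum (finset.setX C D)) A k))).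
  apply: le_measure; rewrite ?inE.
  - rewrite (_ : mkset _ = [set w | (j%:R : R) <= (longest_cup (Z ^~ w))%:R]).
      apply: measurable_le; first exact: measurable_cst.
      exact: (@measurable_longest_cup R d O 'I_n (fun w i => Z i w)).
    by apply/seteqP; split=> w /=; rewrite ler_nat.
  - exact: bigsetU_measurable.
  move=> w /= jw; have [J cJ JE] := longest_cupP (Z ^~ w).
  rewrite -JE in jw; have /card_geqP[s [su ss sJ]] := jw.
  pose J' := [set i in s]%SET.
  have J'J : J' \subset J by apply/fintype.subsetP => i; rewrite inE => /sJ.
  have J'j : #|J'| == j by rewrite cardsE (card_uniqP su) ss.
  have [c' [cS cm cR]] := cup_code m0 (cup_sub J'J cJ).
  pose t := [tuple Ordinal (cm i (ltn_ord i)) | i < m].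
  have tE i : (i < m)%N -> c t i = c' i.
    move=> im; rewrite /c (nth_map (Ordinal (cm (Ordinal im) (ltn_ord _)))).
      by rewrite -(tnth_nth _ t (Ordinal im)) tnth_mktuple.
    by rewrite size_tuple.
  have tC : t \in C.
    rewrite inE; apply/(sortedP 0%N) => i; rewrite size_map size_tuple => im.
    by rewrite -/(c t i) -/(c t i.+1) !tE//; [exact: cS|exact: ltnW].
  have JD : J' \in D by rewrite inE.
  rewrite -bigcup_seq; exists (t, J').
    by rewrite /mkset mem_enum finset.in_setX tC JD.
  move=> i /= iJ'; rewrite (@code_region_ext R m _ c').
    exact: cR.
  exact: tE.
apply: (le_trans (measure_bigU_le _ _ mA)).
rewrite big_enum /=.
apply: (@le_trans _ _ (\sum_(k in finset.setX C D)
    ((6 / m%:R ^+ 2 / a) ^+ j)%:E)%E).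
  apply: lee_sum => -[t J]; rewrite !inE => /andP[tC /eqP Jj].
  rewrite -Jj; apply: sample_inside; first exact: measurable_code_region.
  apply: area_code_region => //.
    move=> i im; move/(sortedP 0%N) : tC => /(_ i).
    by rewrite size_map size_tuple; exact.
  move=> i im.
  rewrite /c (nth_map (Ordinal (leq_trans im (leq_pmull m (isT : 0 < 4)%N)))).
    exact: ltn_ord.
  by rewrite size_tuple.
rewrite sumEFin lee_fin sumr_const cardsX -[leLHS]mulr_natl.
by rewrite card_ltn_sorted_tuples card_draws card_ord.
Qed.

(** The length is at most [K * m], except on an event of probability at most
[1 / n], where it is at most [n]. *)
Lemma expected_cup_le (m K : nat) : (0 < m)%N -> (n <= m ^ 3)%N ->
  (8 <= K)%N -> 48 <= K%:R * a ->
  (expected_cup P Z <= ((K * m)%:R + 1)%:E)%E.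
Proof.
move=> m0 nm K8 Ka; have [mZ _ _] := sZ; set j := (K * m)%N.
pose B := [set w | (j <= longest_cup (Z ^~ w))%N].
have mB : measurable B.
  rewrite (_ : B = [set w | (j%:R : R) <= (longest_cup (Z ^~ w))%:R]).
    apply: measurable_le; first exact: measurable_cst.
    exact: (@measurable_longest_cup R d O 'I_n (fun w i => Z i w)).
  by apply/seteqP; split=> w /=; rewrite ler_nat.
apply: (@le_trans _ _ (\int[P]_w ((j%:R)%:E + n%:R%:E * (\1_B w)%:E))%E).
  apply: ge0_le_integral => //.
  - exact: measurable_sample_cup.
  - apply: emeasurable_funD; first exact: measurable_cst.
    apply: emeasurable_funM; first exact: measurable_cst.
    by apply/measurable_EFinP; exact: measurable_indic.
  - move=> w _; rewrite -EFinM -EFinD lee_fin indicE -natrM -natrD ler_nat.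
    have := longest_cup_leq_card (Z ^~ w); rewrite [X in (_ <= X)%N -> _]card_ord.
    have [wB|wB] := boolP (w \in B); first by rewrite muln1; lia.
    move=> _; rewrite muln0 addn0; apply: contraNT wB; rewrite -ltnNge => /ltnW jw.
    by rewrite inE.
rewrite ge0_integralD//; last first.
  apply: emeasurable_funM; first exact: measurable_cst.
  by apply/measurable_EFinP; exact: measurable_indic.
rewrite integral_cst//= probability_setT mule1 EFinD leeD2l//.
rewrite ge0_integralZl//; last first.
  by apply/measurable_EFinP; exact: measurable_indic.
rewrite integral_indic// setIT.
apply: (@le_trans _ _ (n%:R%:E *
    (('C(4 * m, m) * 'C(n, j))%:R * (6 / m%:R ^+ 2 / a) ^+ j)%:E)%E).
  by rewrite lee_wpmul2l ?lee_fin//; exact: cup_tail.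
by rewrite -EFinM lee_fin mulrA; exact: tail_numeric.
Qed.

End upper_bound.

(** * Limits at the cubic scale *)

Section cube_root.
Variable R : realType.

Definition cbrt (n : nat) : R := n%:R `^ 3^-1.

Lemma cbrt_ge0 n : 0 <= cbrt n. Proof. exact: powR_ge0. Qed.

Lemma cbrtX3 n : cbrt n ^+ 3 = n%:R.
Proof. by rewrite /cbrt -powR_mulrn ?powR_ge0// -powRrM mulVf// powRr1. Qed.

Lemma cbrt_gt0 n : (0 < n)%N -> 0 < cbrt n.
Proof. by move=> n0; apply: powR_gt0; rewrite ltr0n. Qed.

Lemma le_cbrt (x y : R) : 0 <= x -> 0 <= y -> x ^+ 3 <= y ^+ 3 -> x <= y.
Proof. by move=> x0 y0; rewrite ler_pXn2r// nnegrE. Qed.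

Lemma cbrt_grows (m : nat) (e : R) : 0 < e ->
  exists N, forall n, (N <= n)%N -> cbrt m <= e * cbrt n.
Proof.
move=> e0; exists (Num.truncn (m%:R / e ^+ 3)).+1 => n Nn.
apply: le_cbrt; [exact: cbrt_ge0|by rewrite mulr_ge0 ?cbrt_ge0// ltW|].
rewrite exprMn !cbrtX3 mulrC -ler_pdivrMr ?exprn_gt0//.
by apply: ltW; apply: (lt_le_trans (truncnS_gt _)); rewrite ler_nat.
Qed.

End cube_root.

Lemma geometric_small (R : realType) (z e : R) : 0 <= z < 1 -> 0 < e ->
  exists M, forall m, (M <= m)%N -> z ^+ m <= e.
Proof.
move=> /andP[z0 z1] e0.
have /cvgrPdist_le /(_ e e0) : z ^+ n @[n --> \oo] --> (0 : R).
  by apply: cvg_expr; rewrite ger0_norm.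
move=> [M _ MP]; exists M => m /MP /=.
by rewrite sub0r normrN ger0_norm ?exprn_ge0.
Qed.

Section cubic_limit.
Context (R : realType) (u : nat -> R) (K : R) (rho : R -> R).
Hypotheses (u0 : forall n, 0 <= u n) (u1 : 0 < u 1)
  (uK : forall n m, (0 < m)%N -> (n <= m ^ 3)%N -> u n <= K * m%:R)
  (rho01 : forall e, 0 < e -> 0 < rho e < 1)
  (u_super : forall n m k e, (0 < k)%N -> 0 < e ->
    (1 + e) * m%:R * k%:R ^+ 3 <= n%:R ->
    k%:R * (1 - rho e ^+ m) * u m <= u n).

Let r n := cbrt R n.
Let a n := u n / r n.

Let a0 n : 0 <= a n. Proof. by rewrite divr_ge0// cbrt_ge0. Qed.

Let rho_m e m : 0 < e -> 0 <= 1 - rho e ^+ m.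
Proof.
by move=> /rho01/andP[h1 h2]; rewrite subr_ge0 exprn_ile1// ltW.
Qed.

(* With [k] the integer part of [r n / (r m * (1 + e))]; the cube of [1 + e]
   is at least [1 + e], so that this [k] is admissible. *)
Let a_step n m e : (0 < n)%N -> (0 < m)%N -> 0 < e ->
  ((1 + e)^-1 - r m / r n) * (1 - rho e ^+ m) * a m <= a n.
Proof.
move=> n0 m0 e0; have [rn rm] := (cbrt_gt0 R n0, cbrt_gt0 R m0).
have se : 0 < 1 + e by lra.
have c0 : 0 <= (1 - rho e ^+ m) * a m by rewrite mulr_ge0// rho_m.
rewrite -mulrA; set c := _ * a m in c0 *.
pose x := r n / (r m * (1 + e)).
have x0 : 0 <= x by rewrite divr_ge0// ?mulr_ge0// ltW.
pose k := Num.truncn x.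
have /andP[kx xk] : k%:R <= x < k.+1%:R by exact: truncn_itv.
have -> : (1 + e)^-1 - r m / r n = (x - 1) * (r m / r n).
  by rewrite /x; field; rewrite !gt_eqF.
have rr : 0 < r m / r n by rewrite divr_gt0.
have [k0|k0] := posnP k.
  apply: le_trans (a0 n); rewrite k0 in xk.
  rewrite -mulrA; apply: mulr_le0_ge0; first by lra.
  by rewrite mulr_ge0// ltW.
have h : k%:R * (1 - rho e ^+ m) * u m <= u n.
  apply: u_super => //.
  rewrite -[n%:R](cbrtX3 R) -[m%:R](cbrtX3 R) -/(r n) -/(r m).
  apply: (@le_trans _ _ ((k%:R * (r m * (1 + e))) ^+ 3)).
    have -> : (k%:R * (r m * (1 + e))) ^+ 3 =
      (1 + e) ^+ 3 * r m ^+ 3 * k%:R ^+ 3 by ring.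
    rewrite ler_wpM2r ?exprn_ge0//; rewrite ler_wpM2r ?exprn_ge0 ?(ltW rm)//.
    by apply: ler_eXnr => //; lra.
  apply: lerXn2r; rewrite ?nnegrE ?mulr_ge0 ?(ltW rm) ?(ltW rn) ?(ltW se)//.
  by rewrite -ler_pdivlMr// mulr_gt0.
apply: (@le_trans _ _ (k%:R * (r m / r n) * c)).
  by rewrite ler_wpM2r// ler_wpM2r ?(ltW rr)//; rewrite -natr1 in xk; lra.
rewrite /a /c ler_pdivlMr//.
have -> : k%:R * (r m / r n) * ((1 - rho e ^+ m) * a m) * r n =
    k%:R * (1 - rho e ^+ m) * u m by rewrite /a; field; rewrite !gt_eqF.
exact: h.
Qed.

Let a_le n : (0 < n)%N -> a n <= 2 * K.
Proof.
move=> n0; have rn := cbrt_gt0 R n0.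
have r1 : 1 <= r n.
  apply: le_cbrt; rewrite ?cbrt_ge0//.
  by rewrite expr1n cbrtX3 ler1n.
pose m := (Num.truncn (r n)).+1.
have /andP[h1 h2] : (Num.truncn (r n))%:R <= r n < m%:R.
  by apply: truncn_itv; exact: ltW.
have nm : (n <= m ^ 3)%N.
  rewrite -(ler_nat R) natrX -(cbrtX3 R n) lerXn2r ?nnegrE ?cbrt_ge0//.
  exact: ltW.
have h := uK (ltn0Sn _ : 0 < m)%N nm.
have K0 : 0 <= K.
  have := uK (isT : 0 < 1)%N (isT : 1 <= 1 ^ 3)%N; rewrite mulr1.
  by apply: le_trans; exact: ltW.
rewrite /a ler_pdivrMr//; apply: (le_trans h).
by rewrite /m -natr1; nra.
Qed.

Let A := [set l : R | forall N, exists2 n, (N <= n)%N & l <= a n].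

Let a_close e : 0 < e < 2^-1 -> exists M, forall m, (M <= m)%N ->
  exists N, forall n, (N <= n)%N -> (1 - 3 * e) * a m <= a n.
Proof.
move=> /andP[e0 e1]; have /andP[h1 h2] := rho01 e0.
have [|M MP] := @geometric_small R (rho e) e _ e0; first by rewrite h2 ltW.
exists M.+1 => m Mm; have rm := MP m (ltnW Mm).
have [N NP] := cbrt_grows m e0.
exists N.+1 => n Nn; have n0 : (0 < n)%N by apply: leq_trans Nn.
have m0 : (0 < m)%N by apply: leq_trans Mm.
apply: le_trans (a_step n0 m0 e0); apply: ler_wpM2r => //.
have hr : r m / r n <= e.
  by rewrite ler_pdivrMr ?cbrt_gt0//; apply: NP; exact: ltnW.
have hs : 1 - e <= (1 + e)^-1.
  by rewrite -[leRHS]mul1r ler_pdivlMr; nra.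
have hm := rho_m m e0.
apply: (@le_trans _ _ ((1 - 2 * e) * (1 - e))); first by nra.
by apply: ler_pM; lra.
Qed.

(** Once the ratio of a large [m] comes close to the supremum [alpha] of [A], so
do all sufficiently late ratios by [a_close]; and no ratio exceeds [alpha] by
much infinitely often. *)
Lemma cubic_limit : exists2 alpha : R, 0 < alpha &
  u n / cbrt R n @[n --> \oo] --> alpha.
Proof.
pose l0 := 4^-1 * (1 - rho 1) * u 1.
have /andP[p0 p1] := rho01 (ltr01 : 0 < 1 :> R).
have l0_gt0 : 0 < l0 by rewrite !mulr_gt0// subr_gt0.
have r1 : r 1 = 1 by rewrite /r /cbrt powR1.
have Al0 : A l0.
  move=> N; have [N' N'P] := cbrt_grows 1 (ltac:(lra) : 0 < 4^-1 :> R).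
  pose n := (maxn N N').+1.
  have n0 : (0 < n)%N by [].
  exists n; first by rewrite ltnW// ltnS leq_maxl.
  apply: le_trans (a_step n0 (isT : 0 < 1)%N (ltr01 : 0 < 1 :> R)).
  have hr : r 1 / r n <= 4^-1.
    rewrite ler_pdivrMr ?cbrt_gt0//; apply: N'P.
    by rewrite ltnW// ltnS leq_maxr.
  rewrite /a [u 1 / _](_ : _ = u 1) ?expr1; last by rewrite r1 divr1.
  apply: ler_wpM2r; first exact: ltW.
  apply: ler_wpM2r; first by rewrite subr_ge0 ltW.
  have -> : (1 + 1)^-1 = 2^-1 :> R by [].
  by lra.
have hA : has_sup A.
  split; first by exists l0.
  exists (2 * K) => l /(_ 1%N)[n n1 /le_trans]; apply; exact: a_le.
pose alpha := sup A.
have al0 : 0 < alpha.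
  by apply: lt_le_trans l0_gt0 _; apply: sup_upper_bound.
exists alpha => //.
apply/cvgrPdist_le => eta eta0.
have [N1 N1P] : exists N, forall n, (N <= n)%N -> a n <= alpha + eta.
  apply: contrapT => H; suff : A (alpha + eta).
    by move/(sup_upper_bound hA); rewrite gerDl leNgt eta0.
  move=> N; apply: contrapT => H'; apply: H; exists N => n Nn.
  by rewrite leNgt; apply/negP => h; apply: H'; exists n => //; exact: ltW.
have [l Al lP] := sup_adherent (ltac:(lra) : 0 < eta / 2) hA.
rewrite -/alpha in lP.
have lal : l <= alpha by exact: sup_upper_bound.
pose e := Num.min (4^-1) (eta / (6 * alpha)).
have e_eta : e * (6 * alpha) <= eta.
  by rewrite -ler_pdivlMr ?mulr_gt0// ge_min lexx orbT.
have e0 : 0 < e by rewrite lt_min divr_gt0 ?mulr_gt0// andbT; lra.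
have e4 : e <= 4^-1 by rewrite ge_min lexx.
have [|M MP] := @a_close e; first by rewrite e0 /=; lra.
have [m Mm lm] := Al M; have [N2 N2P] := MP m Mm.
exists (maxn N1 N2) => // n /=; rewrite geq_max => /andP[n1 n2].
rewrite -/(r n) -/(a n) ler_distl.
have h1 := N1P n n1; have h2 := N2P n n2.
by apply/andP; split; nra.
Qed.

End cubic_limit.

(** * From a triangle to the standard one *)

(** The integral of a nonnegative function is the supremum of those of the simple
functions below it. *)
Lemma le_nneg_integral (R : realType) d (T : measurableType d)
    (mu : {measure set T -> \bar R}) (f g : T -> \bar R) :
  (forall w, 0 <= f w)%E -> (forall w, f w <= g w)%E ->
  (\int[mu]_w f w <= \int[mu]_w g w)%E.
Proof.
move=> f0 fg; have g0 w : (0 <= g w)%E by exact: le_trans (fg w).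
rewrite !ge0_integralTE//; apply: ereal_sup_le => _ [h hf <-].
exists h => //= w.
exact: le_trans (fg w).
Qed.

(** For the comparison of the longest chain [f] with its measurable description
[g], which is valid on points of the triangle, hence almost surely. *)
Lemma integral_off_null (R : realType) d (T : measurableType d)
    (P : probability T R) (N : set T) (f g : T -> R) (b : R) :
  measurable N -> P N = 0%E -> measurable_fun setT g -> 0 <= b ->
  (forall w, 0 <= f w <= b) -> (forall w, 0 <= g w <= b) ->
  (forall w, ~ N w -> f w = g w) ->
  (\int[P]_w (f w)%:E = \int[P]_w (g w)%:E)%E.
Proof.
move=> mN PN mg b0 fb gb fg.
have mgE : measurable_fun setT (EFin \o g) by exact/measurable_EFinP.
have mI : measurable_fun setT (fun w => b%:E * (\1_N w)%:E : \bar R)%E.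
  apply: emeasurable_funM; first exact: measurable_cst.
  by apply/measurable_EFinP; exact: measurable_indic.
have I0 : (\int[P]_w (b%:E * (\1_N w)%:E) = 0)%E.
  rewrite ge0_integralZl//; last by apply/measurable_EFinP; exact: measurable_indic.
  by rewrite integral_indic// setIT [X in (_ * X)%E]PN mule0.
have inN w : N w -> \1_N w = 1 :> R by move=> Nw; rewrite indicE mem_set.
have ninN w : ~ N w -> \1_N w = 0 :> R by move=> Nw; rewrite indicE memNset.
apply/eqP; rewrite eq_le; apply/andP; split.
  apply: (@le_trans _ _ (\int[P]_w ((g w)%:E + b%:E * (\1_N w)%:E))%E).
    apply: le_nneg_integral => w; first by rewrite lee_fin; have /andP[] := fb w.
    rewrite -EFinM -EFinD lee_fin; have [Nw|Nw] := pselect (N w).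
      rewrite inN// mulr1; have /andP[_ fw] := fb w; have /andP[gw _] := gb w.
      by rewrite (le_trans fw)// lerDr.
    by rewrite ninN// mulr0 addr0 fg.
  rewrite ge0_integralD//; last 2 first.
  - by move=> w _; rewrite lee_fin; have /andP[] := gb w.
  - by move=> w _; rewrite mule_ge0// lee_fin.
  by rewrite I0 adde0.
pose g' w : \bar R := if w \in N then 0%E else (g w)%:E.
have mg' : measurable_fun setT g'.
  have -> : g' = ((EFin \o g) \_ (~` N)).
    by apply/funext => w; rewrite /g' patchE in_setC; case: (w \in N).
  apply/(measurable_restrictT _ (measurableC mN)).
  exact: measurable_funS mgE.
have g'0 w : (0 <= g' w)%E.
  by rewrite /g'; case: ifP => // _; rewrite lee_fin; have /andP[] := gb w.
apply: (@le_trans _ _ (\int[P]_w (g' w + b%:E * (\1_N w)%:E))%E).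
  apply: le_nneg_integral => w; first by rewrite lee_fin; have /andP[] := gb w.
  rewrite /g'; case: ifPn => Nw; last by rewrite leeDl// mule_ge0// lee_fin.
  rewrite add0e -EFinM lee_fin inN ?mulr1; last by rewrite inE in Nw.
  by have /andP[] := gb w.
rewrite ge0_integralD//; last by move=> w _; rewrite mule_ge0// lee_fin.
rewrite I0 adde0; apply: le_nneg_integral => // w.
rewrite /g'; case: ifPn => Nw; first by rewrite lee_fin; have /andP[] := fb w.
by rewrite fg// => /mem_set; rewrite (negbTE Nw).
Qed.

Lemma longest_chain_le (R : realType) (p0 p2 : R * R) (S : {fset R * R}) :
  (longest_chain p0 p2 S <= #|` S|)%N.
Proof.
rewrite /longest_chain big_seq_cond; apply/bigmax_leqP_seq => Y _ /andP[+ _].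
by rewrite fpowersetE => /fsubset_leq_card.
Qed.

Lemma normalize_sample (R : realType) (p0 p1 p2 : R * R) d
    (O : measurableType d) (P : probability O R) n
    (X : 'I_n -> {RV P >-> (R * R)%type}) :
  nondegenerate_triangle p0 p1 p2 -> mutually_independent X ->
  (forall i, uniform_on (triangle p0 p1 p2) (X i)) ->
  exists2 Z : 'I_n -> O -> R * R, std_sample P Z &
  ('E_P[fun w => (longest_chain p0 p2 (random_set X w))%:R] =
     expected_cup P Z)%E.
Proof.
move=> nd ind unif.
have [u [v [D0 f0 f2 TE]]] := triangle_frame nd.
have [p' [u' [v' [D0' fK fK']]]] := frame_inv p0 D0.
set f := frame p0 u v in f0 f2 TE fK fK'; set g := frame p' u' v' in fK fK'.
have [c c0 [mg sg]] := scales_area_frame p' D0'; rewrite -/g in mg sg.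
have mpre A : measurable A -> measurable (g @^-1` A).
  by move=> mA; rewrite -[X in measurable X]setTI; exact: mg.
have mT := @measurable_std_triangle R.
have Tg : triangle p0 p1 p2 = g @^-1` @std_triangle R.
  rewrite TE; apply/seteqP; split=> [_ [q Tq <-]|q Tq] /=; first by rewrite fK.
  by exists (g q); rewrite ?fK'.
have [a a_gt0 aE] := area_std_triangle R.
pose Z i w := g (X i w).
have mZ i : measurable_fun setT (Z i).
  by apply: (measurableT_comp mg); exact: measurable_funPT.
have uZ i A : measurable A -> P (Z i @^-1` A) = std_uniform A.
  move=> mA; have := unif i _ (mpre _ mA).
  rewrite /distribution /pushforward Tg -preimage_setI.
  rewrite !sg//; last exact: measurableI.
  rewrite /std_uniform => ->; rewrite aE.
  have : (area (A `&` @std_triangle R) <= a%:E)%E.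
    by rewrite -aE; apply: le_area => //; exact: measurableI.
  have : (0 <= area (A `&` @std_triangle R))%E by [].
  case: (area _) => [x|//|//] _ _.
  rewrite -!EFinM !inver !gt_eqF ?mulr_gt0// -!EFinM; congr EFin.
  by field; rewrite !gt_eqF.
have sZ : std_sample P Z.
  split=> // A mA; have := ind [set: 'I_n]%SET (fun i => g @^-1` A i)
    (fun i _ => mpre _ (mA i)).
  rewrite (_ : \bigcap_(i in _) _ = [set w | forall i, A i (Z i w)]).
    by move=> ->; apply: eq_bigl => i; rewrite !inE.
  apply/seteqP; split=> w Hw i; last by move=> _; exact: Hw.
  by apply: Hw; rewrite /= inE.
exists Z => //; rewrite unlock /expected_cup.
pose N := [set w | exists i, (~` @std_triangle R) (Z i w)].
have mNi i : measurable (Z i @^-1` (~` @std_triangle R)).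
  rewrite -[X in measurable X]setTI; apply: mZ => //.
  exact: measurableC.
have mN : measurable N.
  exact: (measurable_exists (A := fun i => Z i @^-1` (~` @std_triangle R))).
have PN : P N = 0%E.
  apply/eqP; rewrite eq_le measure_ge0 andbT.
  apply: (@le_trans _ _ (P (\big[setU/set0]_(i <- enum 'I_n)
      Z i @^-1` (~` @std_triangle R)))).
    apply: le_measure; rewrite ?inE//; first exact: bigsetU_measurable.
    move=> w [i Hi]; rewrite -bigcup_seq; exists i => //=.
    by rewrite mem_enum.
  apply: (le_trans (measure_bigU_le _ _ mNi)); rewrite big1// => i _.
  rewrite [LHS](uZ i _ (measurableC mT)) /std_uniform.
  by rewrite setICl /area measure0 mul0e.
apply: (@integral_off_null R _ _ P N _ _ n%:R mN PN).
- exact: (@measurable_longest_cup R d O 'I_n (fun w i => Z i w)).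
- by [].
- move=> w; rewrite ler0n ler_nat.
  apply: leq_trans (longest_chain_le _ _ _) _.
  apply: leq_trans (leq_imfset_card _ _ _) _.
  by rewrite /= size_enum_ord.
- move=> w; rewrite ler0n ler_nat.
  by have := longest_cup_leq_card (Z ^~ w); rewrite [X in (_ <= X)%N -> _]card_ord.
- move=> w Nw; congr (_%:R).
  have ZT i : std_triangle (Z i w) by apply: contrapT => H; apply: Nw; exists i.
  rewrite -(longest_chainE ZT) -{1}f0 -{1}f2.
  have -> : random_set X w =
      [fset f y | y in [fset Z i w | i : 'I_n]%fset]%fset.
    apply/fsetP => q; apply/imfsetP/imfsetP => /=.
      move=> [i _ ->]; exists (Z i w); last by rewrite /Z fK'.
      by apply/imfsetP; exists i.
    by move=> [_ /imfsetP[i _ ->] ->]; exists i => //; rewrite /Z fK'.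
  apply: longest_chain_affine; first exact: frame_affine.
  exact: can_inj fK.
Qed.

(** Each sample, seen as a thinning that keeps all points, bounds the
other. *)
Lemma expected_cup_law (R : realType) d (O : measurableType d)
    (P : probability O R) d' (O' : measurableType d') (P' : probability O' R)
    n (Z : 'I_n -> O -> R * R) (Z' : 'I_n -> O' -> R * R) :
  std_sample P Z -> std_sample P' Z' -> expected_cup P Z = expected_cup P' Z'.
Proof.
have thin d1 (O1 : measurableType d1) (P1 : probability O1 R)
    (Y : 'I_n -> O1 -> R * R) : std_sample P1 Y -> thin_sample P1 1 Y.
  by move=> [mY iY uY]; split=> // i A mA _; rewrite mul1e uY.
have one : binomial_tail n (1 : R) n = 1.
  have := @sum_pattern R n 1 (1 - 1); rewrite [1 + (1 - 1)]addrC subrK expr1n.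
  rewrite (bigID (fun J : {set 'I_n} => (n <= #|J|)%N)) /=.
  rewrite [X in _ + X]big1 ?addr0// => J; rewrite -ltnNge => Jn.
  by rewrite subrr expr0n subn_eq0 leqNgt Jn mulr0.
have b01 : 0 <= (1 : R) <= 1 by rewrite ler01 lexx.
move=> sZ sZ'; apply/eqP; rewrite eq_le.
have := thin_sample_cup b01 (thin _ _ _ _ sZ) sZ'; rewrite one mul1e => ->.
by have := thin_sample_cup b01 (thin _ _ _ _ sZ') sZ; rewrite one mul1e => ->.
Qed.

Lemma expected_cup_fin (R : realType) d (O : measurableType d)
    (P : probability O R) n (Z : 'I_n -> O -> R * R) : std_sample P Z ->
  exists2 e : R, 0 <= e & expected_cup P Z = e%:E.
Proof.
move=> [mZ _ _]; have h0 : (0 <= expected_cup P Z)%E.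
  by apply: integral_ge0 => w _; rewrite lee_fin.
have h1 : (expected_cup P Z <= n%:R%:E)%E.
  have -> : n%:R%:E = (\int[P]_w (n%:R)%:E)%E.
    by rewrite integral_cst//= probability_setT mule1.
  apply: le_nneg_integral => w; rewrite lee_fin// ler_nat.
  by have := longest_cup_leq_card (Z ^~ w); rewrite [X in (_ <= X)%N -> _]card_ord.
by move: h0 h1; case: (expected_cup P Z) => [e|//|//]; rewrite lee_fin; exists e.
Qed.

Lemma expected_cup1_gt0 (R : realType) d (O : measurableType d)
    (P : probability O R) (Z : 'I_1 -> O -> R * R) :
  std_sample P Z -> (0 < expected_cup P Z)%E.
Proof.
move=> [mZ _ uZ]; have [a a0 aE] := area_std_triangle R.
have mL := @measurable_low_box R.
pose B := Z 0 @^-1` @low_box R.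
have mB : measurable B by rewrite -[X in measurable X]setTI; exact: mZ.
apply: (@lt_le_trans _ _ (P B)).
  rewrite uZ// /std_uniform setIidl; last exact: low_box_sub.
  by rewrite aE inver gt_eqF// mule_gt0 ?area_low_box// lte_fin invr_gt0.
rewrite -[P B]mul1e -[X in (_ * P X)%E]setIT -integral_indic// mul1e.
apply: le_nneg_integral => w; first by rewrite lee_fin.
rewrite lee_fin indicE; have [wB|//] := boolP (w \in B).
rewrite ler_nat (leq_trans _ (@longest_cup_ge _ _ (Z ^~ w) [set: 'I_1]%SET _))//.
  by rewrite cardsT card_ord.
move=> i _; rewrite (ord1 i); rewrite inE /B /= in wB.
split; first exact: low_box_sub.
(* lines of slope 1 are parallel to the diagonal, which is above the box *)
have sup (q : R * R) : @low_box R q ->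
    q.2 - 1 * q.1 < 0 /\ q.2 + 1 * (1 - q.1) < 1.
  case: q => x y; rewrite /low_box /= !in_itv /= => -[/andP[h1 h2] /andP[h3 h4]].
  by split; lra.
by have [s0 s1] := sup _ wB; exists 1; split => // j _; rewrite (ord1 j).
Qed.

Lemma std_samples_limit (R : realType) (d : nat -> measure_display)
    (O : forall n, measurableType (d n)) (P : forall n, probability (O n) R)
    (Z : forall n, 'I_n -> O n -> R * R) :
  (forall n, std_sample (P n) (Z n)) ->
  exists2 alpha : R, 0 < alpha &
    (expected_cup (P n) (Z n) / (n%:R `^ 3^-1)%:E)%E @[n --> \oo] --> alpha%:E.
Proof.
move=> sZ; have [a a0 aE] := area_std_triangle R.
have /choice[u uP] : forall n, exists e : R,
    0 <= e /\ expected_cup (P n) (Z n) = e%:E.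
  by move=> n; have [e] := expected_cup_fin (sZ n); exists e.
pose K := (maxn 8 (Num.truncn (48 / a)).+1)%N.
have K8 : (8 <= K)%N by rewrite leq_maxl.
have Ka : 48 <= K%:R * a.
  rewrite -ler_pdivrMr//; apply: ltW; apply: (lt_le_trans (truncnS_gt _)).
  by rewrite ler_nat leq_maxr.
have [||n m m0 nm||n m k e k0 e0 h|alpha al0 ual] :=
  @cubic_limit R u (K%:R + 1) (@chernoff R).
- by move=> n; have [] := uP n.
- by rewrite -lte_fin -(uP 1%N).2; exact: expected_cup1_gt0.
- have := expected_cup_le (sZ n) a0 aE m0 nm K8 Ka.
  rewrite (uP n).2 lee_fin => /le_trans; apply.
  by rewrite natrM mulrDl mul1r lerD2l ler1n.
- exact: chernoff_lt1.
- have := expected_cup_superadditive (sZ n) (sZ m) k0 e0 h.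
  by rewrite (uP n).2 (uP m).2 -EFinM lee_fin.
have ratioE n : (0 < n)%N ->
    (expected_cup (P n) (Z n) / (n%:R `^ 3^-1)%:E)%E = (u n / cbrt R n)%:E.
  by move=> n0; rewrite (uP n).2 inver gt_eqF ?(cbrt_gt0 R n0).
exists alpha => //; apply/fine_cvgP; split.
  by exists 1%N => // n /= n0; rewrite ratioE.
apply: (cvg_trans _ ual); apply: near_eq_cvg.
by exists 1%N => // n /= n0; rewrite ratioE.
Qed.
Theorem theorem2p1 (R : realType) :
  exists2 alpha : R, 0 < alpha &
  forall (p0 p1 p2 : R * R), nondegenerate_triangle p0 p1 p2 ->
  forall (d : nat -> measure_display)
         (Omega : forall n : nat, measurableType (d n))
         (P : forall n : nat, probability (Omega n) R)
         (X : forall n : nat, 'I_n -> {RV (P n) >-> (R * R)%type}),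
    (forall n : nat, mutually_independent (X n)) ->
    (forall (n : nat) (i : 'I_n), uniform_on (triangle p0 p1 p2) (X n i)) ->
    ('E_(P n)[fun w => (longest_chain p0 p2 (random_set (X n) w))%:R]
       / (n%:R `^ 3^-1)%:E)%E @[n --> \oo] --> alpha%:E.
Proof.
(* With no sequence of samples at all, any constant would do. *)
have [ [d [W [P [Z sZ]]]] | noZ] := pselect (exists (d : nat -> measure_display)
    (W : forall n, measurableType (d n)) (P : forall n, probability (W n) R)
    (Z : forall n, 'I_n -> W n -> R * R), forall n, std_sample (P n) (Z n));
  last first.
  exists 1 => // p0 p1 p2 nd d O P X ind unif; exfalso; apply: noZ.
  have exZ n : exists Z : 'I_n -> O n -> R * R, std_sample (P n) Z.
    by have [Z] := normalize_sample nd (ind n) (unif n); exists Z.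
  exists d, O, P, (fun n => sval (cid (exZ n))) => n.
  exact: svalP (cid (exZ n)).
have [alpha al0 Zal] := std_samples_limit sZ.
exists alpha => // p0 p1 p2 nd d' O' P' X ind unif.
rewrite (_ : (fun n => _) = (fun n => expected_cup (P n) (Z n)
    / (n%:R `^ 3^-1)%:E)%E)//.
apply/funext => n; congr (_ / _)%E.
have [Z' sZ' ->] := normalize_sample nd (ind n) (unif n).
exact: expected_cup_law.
Qed.
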